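(* Let $E$, $\mu$, $\mathcal{E}$, $(T_t)_{t>0}$, the sectorial Dirichlet form $(\mathcal{E}^0,D(\mathcal{E}^0))$, the linear operator $(N,D(N))$ and the set $D$ be as in the context. (a) If there exists a sequence of functions $(\chi_n)_{n\ge1}\subset D$ with $0\le\chi_n\le1$ and $\lim_{n\to\infty}\chi_n=1$ $\mu$-a.e. satisfying $$\lim_{n\to\infty}\Big(\mathcal{E}^0(g,\chi_n)+\int_E g\,N\chi_n\,d\mu\Big)=0$$ for any non-negative bounded $g$ in the extended Dirichlet space of $D(\mathcal{E}^0)$, then $(T_t)_{t>0}$ is not transient. (b) If $(T_t)_{t>0}$ is strictly irreducible and there is a sequence of functions $(\chi_n)_{n\ge1}\subset D$ with $0\le\chi_n\le1$ and $\lim_{n\to\infty}\chi_n=1$ $\mu$-a.e. satisfying $$\lim_{n\to\infty}\Big(\mathcal{E}^0(g,\chi_n)+\int_E g\,N\chi_n\,d\mu\Big)=0$$ for any non-negative bounded $g$ in the extended Dirichlet space of $D(\mathcal{E}^0)$, then $(T_t)_{t>0}$ is recurrent.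
   Context: $E$ is a Hausdorff topological space whose Borel $\sigma$-algebra $\mathcal{B}(E)$ is generated by the continuous functions on $E$; $\mu$ is a $\sigma$-finite (nonzero) positive measure on $\mathcal{B}(E)$; $\mathcal{H}:=L^2(E,\mu)$ with inner product $(\cdot,\cdot)$. For a set $W$ of functions on $E$, $W_b$ denotes the set of $\mu$-a.e. bounded elements of $W$. An operator $S$ is sub-Markovian if $0\le f\le 1$ implies $0\le Sf\le 1$; a resolvent $(G_\alpha)_{\alpha>0}$ is sub-Markovian if all $\alpha G_\alpha$ are. Dirichlet forms. A (not necessarily symmetric) Dirichlet form on $\mathcal{H}$ is a bilinear form $\mathcal{A}$ on a dense linear subspace $\mathcal{V}\subset\mathcal{H}$ with $\mathcal{A}(u,u)\ge 0$, such that $\mathcal{V}$ is complete for the norm $\|u\|_{\mathcal{V}}=(\mathcal{A}(u,u)+(u,u))^{1/2}$, the weak sector condition $|\mathcal{A}_1(u,v)|\le K\mathcal{A}_1(u,u)^{1/2}\mathcal{A}_1(v,v)^{1/2}$ holds for some $K>0$ (with $\mathcal{A}_1=\mathcal{A}+(\cdot,\cdot)$), and for all $u\in\mathcal{V}$: $u^+\wedge 1\in\mathcal{V}$, $\mathcal{A}(u+u^+\wedge 1,u-u^+\wedge 1)\ge 0$ and $\mathcal{A}(u-u^+\wedge 1,u+u^+\wedge 1)\ge 0$. It is called sectorial if it moreover satisfies the strong sector condition $|\mathcal{A}(u,v)|\le K\mathcal{A}(u,u)^{1/2}\mathcal{A}(v,v)^{1/2}$ for some $K>0$ and all $u,v$.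 Framework. $(\mathcal{A},\mathcal{V})$ is a (not necessarily symmetric) Dirichlet form on $\mathcal{H}$, $\mathcal{V}'$ is the dual of $\mathcal{V}$ (with $\mathcal{V}\subset\mathcal{H}\subset\mathcal{V}'$), and $(\Lambda,D(\Lambda,\mathcal{H}))$ is a linear operator on $\mathcal{H}$ which generates a sub-Markovian $C_0$-semigroup of contractions on $\mathcal{H}$ that can be restricted to a $C_0$-semigroup on $\mathcal{V}$. Then $\Lambda:D(\Lambda,\mathcal{H})\cap\mathcal{V}\to\mathcal{V}'$ is closable as an operator from $\mathcal{V}$ to $\mathcal{V}'$; its closure is denoted $(\Lambda,\mathcal{F})$. The associated generalized Dirichlet form satisfies $\mathcal{E}(u,v)=\mathcal{A}(u,v)-{}_{\mathcal{V}'}\langle\Lambda u,v\rangle_{\mathcal{V}}$ for $u\in\mathcal{F}$, $v\in\mathcal{V}$. $(G_\alpha)_{\alpha>0}$ is the sub-Markovian $C_0$-resolvent of contractions on $\mathcal{H}$ with $G_\alpha(\mathcal{H})\subset\mathcal{F}$ and $\mathcal{E}(G_\alpha f,g)+\alpha(G_\alpha f,g)=(f,g)$ for $f\in\mathcal{H}$, $g\in\mathcal{V}$; $(\widehat{G}_\alpha)_{\alpha>0}$ is its adjoint; $(L,D(L))$ is the generator of $(G_\alpha)_{\alpha>0}$; $(T_t)_{t>0}$ and $(\widehat{T}_t)_{t>0}$ are the $C_0$-semigroups of contractions corresponding to $(G_\alpha)_{\alpha>0}$ and $(\widehat{G}_\alpha)_{\alpha>0}$. For $u\in D(L)$ and $v\in\mathcal{H}$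 one writes $\mathcal{E}(u,v)=(-Lu,v)$. It is assumed that $(\widehat{T}_t)_{t>0}$ is sub-Markovian. Hence $(T_t)_{t>0}$ restricted to $L^1(E,\mu)\cap L^2(E,\mu)$ extends to a positivity preserving semigroup of contractions on $L^1(E,\mu)$, also denoted $(T_t)_{t>0}$. Recurrence, transience, irreducibility. For $f\in L^1(E,\mu)$, $f\ge 0$, the potential operator is $Gf:=\lim_{N\to\infty}\int_0^N T_tf\,dt\in[0,\infty]$ ($\mu$-a.e. defined). $(T_t)_{t>0}$ is transient if there is $g\in L^1(E,\mu)$, $g>0$ $\mu$-a.e., with $Gg<\infty$ $\mu$-a.e.; it is recurrent if for every $f\in L^1(E,\mu)$ with $f\ge0$ $\mu$-a.e. one has $Gf(x)\in\{0,\infty\}$ for $\mu$-a.e. $x$. A set $B\in\mathcal{B}(E)$ is weakly invariant relative to $(T_t)_{t>0}$ if $T_t(f\cdot 1_B)(x)=0$ for $\mu$-a.e. $x\in E\setminus B$, for any $t>0$, $f\in L^2(E,\mu)$. $(T_t)_{t>0}$ is strictly irreducible if every weakly invariant set $B$ satisfies $\mu(B)=0$ or $\mu(E\setminus B)=0$. Decomposition assumption. There are a sectorial Dirichlet form $(\mathcal{E}^0,D(\mathcal{E}^0))$ on $L^2(E,\mu)$ with $D(L)_b\subset D(\mathcal{E}^0)$ and a linear operator $(N,D(N))$ on $\mathcal{H}$ (not necessarily a generator) such that $$\mathcal{E}(u,v)=(-Lu,v)=\mathcal{E}^0(u,v)+\int_E u\,Nv\,d\mu\quad\text{for all }u\in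 D(L)_b,\ v\in D(N)\cap D(\mathcal{E}^0),$$ and $\mathcal{E}^0(u,u)\le\mathcal{E}(u,u)$ for all $u\in D(L)_b$. Set $D:=\{u\in D(N)\cap D(\mathcal{E}^0): Nu\in L^1(E,\mu)\}$. The extended Dirichlet space of $D(\mathcal{E}^0)$ is the set of all measurable functions $u$ with $|u|<\infty$ $\mu$-a.e. for which there is an $\mathcal{E}^0$-Cauchy sequence $(u_n)_{n\ge1}\subset D(\mathcal{E}^0)$ with $\lim_{n\to\infty} u_n=u$ $\mu$-a.e. For $g$ in the extended Dirichlet space with such an approximating sequence $(g_n)$ and $u\in D(\mathcal{E}^0)$, $\mathcal{E}^0(g,u):=\lim_{n\to\infty}\mathcal{E}^0(g_n,u)$ (which exists and is independent of $(g_n)$). *)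

(* Defs.v *)
From HB Require Import structures.
From mathcomp Require Import all_boot all_order all_algebra.
From mathcomp Require Import all_classical all_reals all_analysis.

Set Implicit Arguments.
Unset Strict Implicit.
Unset Printing Implicit Defensive.

Import Order.TTheory GRing.Theory Num.Theory.
Import numFieldNormedType.Exports.

Local Open Scope classical_set_scope.
Local Open Scope ring_scope.

(* The measurable space (E, B(E)).  Measurable types are pointed in the library;
   a space carrying a nonzero measure is nonempty anyway. *)
Notation borel E := (g_sigma_algebraType (@open E)).

Definition borel_generated_by_continuous (R : realType)
    (E : ptopologicalType) : Prop :=
  <<s @open E >> =
  <<s [set A : set E | exists2 f : E -> R, continuous f &
        exists2 B : set R, measurable B & A = f @^-1` B] >>.

(* Elements of L^p are represented by functions T -> R; classes modulo a.e.
   equality are accounted for by requiring that subspaces, operators and forms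
   do not distinguish a.e. equal functions.  All identities between values of
   operators are a.e. identities. *)
Section Lp.
Context d (T : measurableType d) (R : realType).
Variable mu : {measure set T -> \bar R}.
Local Notation fn := (T -> R).
Implicit Types (p : \bar R) (u v f g h : fn) (W V D : set fn).

Definition Lp p : set fn := [set f | f \in Lfun mu p].

Definition pnorm p f : R := fine ('N[mu]_p[EFin \o f])%E.

Definition ip f g : R := \int[mu]_x (f x * g x).

Definition ae_nonneg f : Prop := {ae mu, forall x, 0 <= f x}.

Definition ae_bounded f : Prop :=
  exists M : R, {ae mu, forall x, `|f x| <= M}.

Definition ae_unit f : Prop := {ae mu, forall x, 0 <= f x <= 1}.

Record linear_subspace p W : Prop := LinearSubspace {
  subspace_Lp : W `<=` Lp p ;
  subspace0 : W 0 ;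
  subspaceP : forall (a : R) u v, W u -> W v -> W (a *: u + v) ;
  subspace_ae : forall u v, W u -> measurable_fun setT v ->
    u = v %[ae mu] -> W v
}.

Record linear_operator p D (S : fn -> fn) : Prop := LinearOperator {
  operator_dom : linear_subspace p D ;
  operator_Lp : forall u, D u -> Lp p (S u) ;
  operator_ae : forall u v, D u -> D v -> u = v %[ae mu] ->
    S u = S v %[ae mu] ;
  operatorP : forall (a : R) u v, D u -> D v ->
    S (a *: u + v) = a *: S u + S v %[ae mu]
}.

Definition positivity_preserving p (S : fn -> fn) : Prop :=
  forall f, Lp p f -> ae_nonneg f -> ae_nonneg (S f).

Definition sub_markovian (S : fn -> fn) : Prop :=
  forall f, Lp 2%:E f -> ae_unit f -> ae_unit (S f).

Record C0_semigroup p W (nrm : fn -> R) (U : R -> fn -> fn) : Prop :=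
  C0Semigroup {
  semigroup_operator : forall t, 0 < t -> linear_operator p W (U t) ;
  semigroup_stable : forall t u, 0 < t -> W u -> W (U t u) ;
  semigroup_bounded : forall t, 0 < t ->
    exists C : R, forall u, W u -> nrm (U t u) <= C * nrm u ;
  semigroupD : forall s t u, 0 < s -> 0 < t -> W u ->
    U (s + t) u = U s (U t u) %[ae mu] ;
  semigroup_continuous : forall u, W u ->
    nrm (U t u - u) @[t --> (0 : R)^'+] --> (0 : R)
}.

Definition C0_contraction_semigroup (U : R -> fn -> fn) : Prop :=
  C0_semigroup 2%:E (Lp 2%:E) (pnorm 2%:E) U /\
  forall t f, 0 < t -> Lp 2%:E f -> pnorm 2%:E (U t f) <= pnorm 2%:E f.

Definition has_generator_value (U : R -> fn -> fn) u w : Prop :=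
  pnorm 2%:E (t^-1 *: (U t u - u) - w) @[t --> (0 : R)^'+] --> (0 : R).

Definition semigroup_generator (U : R -> fn -> fn) D (S : fn -> fn) : Prop :=
  (forall u, D u <->
     Lp 2%:E u /\ exists2 w, Lp 2%:E w & has_generator_value U u w) /\
  (forall u, D u -> Lp 2%:E (S u) /\ has_generator_value U u (S u)).

Record C0_contraction_resolvent (G : R -> fn -> fn) : Prop :=
  C0ContractionResolvent {
  resolvent_operator : forall a, 0 < a ->
    linear_operator 2%:E (Lp 2%:E) (G a) ;
  resolvent_contraction : forall a f, 0 < a -> Lp 2%:E f ->
    pnorm 2%:E (a *: G a f) <= pnorm 2%:E f ;
  resolvent_equation : forall a b f, 0 < a -> 0 < b -> Lp 2%:E f ->
    G a f - G b f = (b - a) *: G a (G b f) %[ae mu] ;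
  resolvent_continuous : forall f, Lp 2%:E f ->
    pnorm 2%:E (a *: G a f - f) @[a --> +oo] --> (0 : R)
}.

(* D = G_a(H) and S = a - G_a^{-1} on D. *)
Definition resolvent_generator (G : R -> fn -> fn) D (S : fn -> fn) : Prop :=
  linear_operator 2%:E D S /\
  forall a, 0 < a ->
    (forall u, D u <->
       Lp 2%:E u /\ exists2 f, Lp 2%:E f & u = G a f %[ae mu]) /\
    (forall f, Lp 2%:E f -> S (G a f) = a *: G a f - f %[ae mu]).

Definition adjoint_family (G Ghat : R -> fn -> fn) : Prop :=
  forall a f, 0 < a -> Lp 2%:E f -> Lp 2%:E (Ghat a f) /\
    forall g, Lp 2%:E g -> ip (Ghat a f) g = ip f (G a g).

(* The correspondence between semigroups and resolvents: same generator. *)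
Definition semigroup_of_resolvent (U G : R -> fn -> fn) : Prop :=
  C0_contraction_semigroup U /\
  exists D (S : fn -> fn), resolvent_generator G D S /\
    semigroup_generator U D S.

(* The L^1-extension of an L^2-semigroup is carried by the same operators U t,
   so that the two automatically agree on the intersection of L^1 and L^2. *)
Record L1_extension (U : R -> fn -> fn) : Prop := L1Extension {
  L1_operator : forall t, 0 < t -> linear_operator 1%E (Lp 1%E) (U t) ;
  L1_contraction : forall t f, 0 < t -> Lp 1%E f ->
    pnorm 1%E (U t f) <= pnorm 1%E f ;
  L1_positive : forall t, 0 < t -> positivity_preserving 1%E (U t) ;
  L1_semigroup : forall s t f, 0 < s -> 0 < t -> Lp 1%E f ->
    U (s + t) f = U s (U t f) %[ae mu]
}.

Section forms.
Variables (V : set fn) (A : fn -> fn -> R).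

Definition form1 u v : R := A u v + ip u v.

Definition form_norm u : R := Num.sqrt (form1 u u).

Definition form_seminorm u : R := Num.sqrt (A u u).

Definition cauchy_for (nrm : fn -> R) (u_ : nat -> fn) : Prop :=
  forall e : R, 0 < e -> \forall m & n \near \oo, nrm (u_ m - u_ n) < e.

Definition unit_contraction u : fn := fun x => Num.min (Num.max (u x) 0) 1.

Record dirichlet_form : Prop := DirichletForm {
  form_dom : linear_subspace 2%:E V ;
  form_dense : forall f (e : R), Lp 2%:E f -> 0 < e ->
    exists2 v, V v & pnorm 2%:E (f - v) < e ;
  form_ae : forall u u' v v', V u -> V u' -> V v -> V v' ->
    u = u' %[ae mu] -> v = v' %[ae mu] -> A u v = A u' v' ;
  form_linl : forall (a : R) u u' v, V u -> V u' -> V v ->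
    A (a *: u + u') v = a * A u v + A u' v ;
  form_linr : forall (a : R) u v v', V u -> V v -> V v' ->
    A u (a *: v + v') = a * A u v + A u v' ;
  form_ge0 : forall u, V u -> 0 <= A u u ;
  form_complete : forall u_ : nat -> fn, (forall n, V (u_ n)) ->
    cauchy_for form_norm u_ ->
    exists2 u, V u & form_norm (u_ n - u) @[n --> \oo] --> (0 : R) ;
  form_weak_sector : exists2 K : R, 0 < K & forall u v, V u -> V v ->
    `|form1 u v| <= K * Num.sqrt (form1 u u) * Num.sqrt (form1 v v) ;
  form_markov : forall u, V u -> V (unit_contraction u) /\
    0 <= A (u + unit_contraction u) (u - unit_contraction u) /\
    0 <= A (u - unit_contraction u) (u + unit_contraction u)
}.

Definition sectorial_dirichlet_form : Prop :=
  dirichlet_form /\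
  exists2 K : R, 0 < K & forall u v, V u -> V v ->
    `|A u v| <= K * Num.sqrt (A u u) * Num.sqrt (A v v).

Definition approximating (u_ : nat -> fn) u : Prop :=
  [/\ forall n, V (u_ n), cauchy_for form_seminorm u_ &
      {ae mu, forall x, u_ n x @[n --> \oo] --> u x}].

(* A measurable function which is finite a.e. is represented by a real-valued
   one. *)
Definition extended_space : set fn :=
  [set u | measurable_fun setT u /\ exists u_ : nat -> fn, approximating u_ u].

(* A(u, v) for u in the extended space, computed along an approximating
   sequence u_ of u; the value does not depend on that sequence, and
   statements using it quantify over all approximating sequences. *)
Definition extended_form (u_ : nat -> fn) v : R :=
  lim (A (u_ n) v @[n --> \oo]).

(* Elements of the dual V' are functionals on V; only their values on V matter.
   The embedding of L^2 into V' is f |-> ip f. *)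
Definition dual (l : fn -> R) : Prop :=
  (forall (a : R) u v, V u -> V v -> l (a *: u + v) = a * l u + l v) /\
  exists C : R, forall v, V v -> `|l v| <= C * form_norm v.

Definition dual_norm (l : fn -> R) : R :=
  sup [set `|l v| | v in [set v | V v /\ form_norm v <= 1]].

Variables (DLam : set fn) (Lam : fn -> fn).

(* Graph of the closure of Lam : DLam `&` V -> V' as an operator V -> V'. *)
Definition closure_graph u (l : fn -> R) : Prop :=
  [/\ V u, dual l & exists u_ : nat -> fn,
    [/\ forall n, DLam (u_ n) /\ V (u_ n),
        form_norm (u_ n - u) @[n --> \oo] --> (0 : R) &
        dual_norm (fun v => ip (Lam (u_ n)) v - l v) @[n --> \oo]
          --> (0 : R)]].

Definition closure_dom : set fn := [set u | exists l, closure_graph u l].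

Definition closure_op u : fn -> R := xget (fun=> 0) (closure_graph u).

Definition generalized_form u v : R := A u v - closure_op u v.

End forms.

Definition admissible_generator V (A : fn -> fn -> R) DLam (Lam : fn -> fn) :
    Prop :=
  linear_operator 2%:E DLam Lam /\
  exists U : R -> fn -> fn,
    [/\ C0_contraction_semigroup U,
        (forall t, 0 < t -> sub_markovian (U t)),
        semigroup_generator U DLam Lam &
        C0_semigroup 2%:E V (form_norm A) U].

Definition gdf_resolvent V (A : fn -> fn -> R) DLam (Lam : fn -> fn)
    (G : R -> fn -> fn) : Prop :=
  [/\ C0_contraction_resolvent G,
      (forall a, 0 < a -> sub_markovian (fun f => a *: G a f)) &
      forall a f, 0 < a -> Lp 2%:E f ->
        closure_dom V A DLam Lam (G a f) /\
        forall g, V g ->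
          generalized_form V A DLam Lam (G a f) g + a * ip (G a f) g = ip f g].

(* For u in D(L) the generalized form is E(u, v) = (- L u, v). *)
Definition decomposition DL (L : fn -> fn) DE0 (E0 : fn -> fn -> R)
    DN (N : fn -> fn) : Prop :=
  [/\ sectorial_dirichlet_form DE0 E0,
      linear_operator 2%:E DN N,
      (forall u, DL u -> ae_bounded u -> DE0 u),
      (forall u v, DL u -> ae_bounded u -> DN v -> DE0 v ->
         ip (- L u) v = E0 u v + ip u (N v)) &
      (forall u, DL u -> ae_bounded u -> E0 u u <= ip (- L u) u)].

Definition N_domain DE0 DN (N : fn -> fn) : set fn :=
  [set u | [/\ DN u, DE0 u & Lp 1%E (N u)]].

Section potential.
Local Notation leb := (@lebesgue_measure R).

(* A simple function from ]0, M] to L^1, as a finite sum of \1_B *: x. *)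
Definition simple_fun := seq (set R * fn).

Definition simple_on (M : R) (s : simple_fun) : Prop :=
  forall b : 'I_(size s),
    let Bx := tnth (in_tuple s) b in
    [/\ measurable Bx.1, Bx.1 `<=` `]0, M] & Lp 1%E Bx.2].

Definition simple_val (s : simple_fun) (t : R) : fn :=
  \sum_(Bx <- s) \1_(Bx.1) t *: Bx.2.

Definition simple_integral (s : simple_fun) : fn :=
  \sum_(Bx <- s) fine (leb Bx.1) *: Bx.2.

(* Bochner integral of an L^1-valued map; semigroups are only indexed by t > 0,
   hence the interval ]0, M]. *)
Definition is_bochner_integral (F : R -> fn) (M : R) h : Prop :=
  Lp 1%E h /\
  exists s_ : nat -> simple_fun,
    [/\ forall n, simple_on M (s_ n),
        (forall n, measurable_fun `]0, M]
           (fun t => pnorm 1%E (F t - simple_val (s_ n) t))),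
        (\int[leb]_(t in `]0%R, M])
           (pnorm 1%E (F t - simple_val (s_ n) t))%:E)%E
           @[n --> \oo] --> 0%E &
        pnorm 1%E (simple_integral (s_ n) - h) @[n --> \oo] --> (0 : R)].

Definition bochner_integral (F : R -> fn) (M : R) : fn :=
  xget 0 (is_bochner_integral F M).

(* The integrals are a.e. nondecreasing in the upper bound, so that integer
   bounds suffice and avoid an uncountable family of null sets. *)
Definition potential (U : R -> fn -> fn) f : T -> \bar R := fun x =>
  limn (fun n => (bochner_integral (fun t => U t f) n%:R x)%:E).

Definition transient (U : R -> fn -> fn) : Prop :=
  exists g, [/\ Lp 1%E g, {ae mu, forall x, 0 < g x} &
    {ae mu, forall x, (potential U g x < +oo)%E}].

Definition recurrent (U : R -> fn -> fn) : Prop :=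
  forall f, Lp 1%E f -> ae_nonneg f ->
    {ae mu, forall x, potential U f x = 0%E \/ potential U f x = +oo%E}.

End potential.

Definition weakly_invariant (U : R -> fn -> fn) (B : set T) : Prop :=
  measurable B /\
  forall t f, 0 < t -> Lp 2%:E f ->
    {ae mu, forall x, (~` B) x -> U t (f \* \1_B) x = 0}.

Definition strictly_irreducible (U : R -> fn -> fn) : Prop :=
  forall B : set T, weakly_invariant U B -> mu B = 0%E \/ mu (~` B) = 0%E.

Definition vanishing_cutoff DE0 (E0 : fn -> fn -> R) DN (N : fn -> fn)
    (chi : nat -> fn) : Prop :=
  [/\ forall n, N_domain DE0 DN N (chi n),
      forall n, ae_unit (chi n),
      {ae mu, forall x, chi n x @[n --> \oo] --> (1 : R)} &
      forall g, extended_space DE0 E0 g -> ae_nonneg g -> ae_bounded g ->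
        forall g_ : nat -> fn, approximating DE0 E0 g_ g ->
        extended_form E0 g_ (chi n) + ip g (N (chi n)) @[n --> \oo]
          --> (0 : R)].

End Lp.

(* Main.v *)
(* The cutoff condition forces conservativity: if f >= 0 lies in L1, its potential
   is infinite a.e. on {f > 0}. Otherwise some set B, on which f is bounded above
   and away from 0 and its potential is bounded by M, has positive measure. Put
   h = f 1_B. The resolvents G_a h are dominated by the potential of f, hence by M
   on B, and so everywhere by the maximum principle. They increase, as a -> 0, to
   a function v <= M with bounded energies E0(G_a h, G_a h), so that near-minimizers
   of E0 between G_a h and v form an E0-Cauchy sequence w_n -> v along which
   -L w_n -> h in L2. Thus v lies in the extended Dirichlet space and
   E0(v, chi_n) + (v, N chi_n) = (h, chi_n) tends both to 0 and to the integral
   of h > 0, a contradiction. Applied to f > 0 this excludes transience; applied to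
   T_t f, whose potential is at most that of f, it shows T_t f = 0 where the
   potential of f is finite, so that this potential is 0 there. *)
Require Import Defs.
From HB Require Import structures.
From mathcomp Require Import all_boot all_order all_algebra.
From mathcomp Require Import all_classical all_reals all_analysis.
From mathcomp Require Import measurable_realfun.
From mathcomp Require Import ring lra.

Set Implicit Arguments.
Unset Strict Implicit.
Unset Printing Implicit Defensive.

Import Order.TTheory GRing.Theory Num.Theory.
Import numFieldNormedType.Exports.

Local Open Scope classical_set_scope.
Local Open Scope ring_scope.

(** * Real-valued representatives of L1 and L2 *)

Section Lp_basics.
Context d (T : measurableType d) (R : realType).
Variable mu : {measure set T -> \bar R}.
Local Notation fn := (T -> R).
Implicit Types (p : \bar R) (u v f g h : fn).
Local Notation itg f := (mu.-integrable setT (EFin \o f)).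
Local Notation "'J' f" := (Rintegral mu setT f) (at level 10, f at level 9).

(** The semigroup and the resolvent are tied together only by their common generator, and
    [potential] is built from Bochner integrals selected by [xget]: neither a Laplace transform
    formula nor the existence of the integrals is given. Existence comes from dyadic Riemann sums,
    which also carry the inequalities between potentials: these are proved for finite sums and
    passed to the L1 limit. A discrete iteration of the generator equation, tested against
    indicators, stands in for the Laplace transform.

    Exceptional null sets have to come from countable families, so only dyadic times, integer bounds
    and integer levels are used.

    The form argument must stay among bounded elements of [DL], where the decomposition applies;
    hence the cut of [f] to a set whose level [M] spreads to the whole space. Bounded energy alone
    would give weak compactness, whereas the extended space asks for an E0-Cauchy sequence
    converging a.e. Minimizing the energy over midpoint-convex sets of functions squeezed below [v]
    gives both at once. *)

Lemma LpP p f : Lp mu p f <->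
  measurable_fun setT f /\ ('N[mu]_p[EFin \o f] < +oo)%E.
Proof.
split; first by case/andP => /[!inE].
by case=> mf Nf; apply/andP; rewrite !inE.
Qed.

Lemma Lp_measurable p f : Lp mu p f -> measurable_fun setT f.
Proof. by case/LpP. Qed.

Lemma Lp1P f : Lp mu 1%E f <-> itg f.
Proof. exact: Lfun1_integrable. Qed.

Lemma measurable_itg f : itg f -> measurable_fun setT f.
Proof. by move/measurable_int/measurable_EFinP. Qed.

Lemma Lp0 p : (1 <= p)%E -> Lp mu p 0.
Proof. by move=> p1; have [] := Lfun_submod_closed mu p1. Qed.

Lemma Lp_lin p (a : R) u v : (1 <= p)%E -> Lp mu p u -> Lp mu p v ->
  Lp mu p (a *: u + v).
Proof.
by move=> p1 pu pv; have [_ /(_ a u v pu pv)] := Lfun_submod_closed mu p1.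
Qed.

Lemma LpZ p (a : R) u : (1 <= p)%E -> Lp mu p u -> Lp mu p (a *: u).
Proof. by move=> p1 pu; rewrite -[_ *: _]addr0; apply: Lp_lin => //; exact: Lp0. Qed.

Lemma LpD p u v : (1 <= p)%E -> Lp mu p u -> Lp mu p v -> Lp mu p (u + v).
Proof. by move=> p1 pu pv; rewrite -[u]scale1r; exact: Lp_lin. Qed.

Lemma LpB p u v : (1 <= p)%E -> Lp mu p u -> Lp mu p v -> Lp mu p (u - v).
Proof. by move=> p1 pu pv; rewrite addrC -scaleN1r; exact: Lp_lin. Qed.


Lemma pnorm_ge0 p f : 0 <= pnorm mu p f.
Proof. by rewrite fine_ge0// Lnorm_ge0. Qed.

Lemma pnorm_fin p f : Lp mu p f -> (pnorm mu p f)%:E = 'N[mu]_p[EFin \o f]%E.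
Proof. by case/LpP => _ Nf; rewrite fineK// ge0_fin_numE// Lnorm_ge0. Qed.

Lemma ler_pnormD p u v : (1 <= p)%E -> Lp mu p u -> Lp mu p v ->
  pnorm mu p (u + v) <= pnorm mu p u + pnorm mu p v.
Proof.
move=> p1 pu pv; rewrite -lee_fin EFinD !pnorm_fin//; last exact: LpD.
by apply: eminkowski => //; apply: Lp_measurable; eassumption.
Qed.

Lemma pnormZ p (a : R) u : (1 <= p)%E -> Lp mu p u ->
  pnorm mu p (a *: u) = `|a| * pnorm mu p u.
Proof.
move=> p1 pu; apply: EFin_inj; rewrite EFinM !pnorm_fin//; last exact: LpZ.
exact: (LnormZ (Lfun_Sub p1 pu) a).
Qed.

Lemma pnormN p u : (1 <= p)%E -> Lp mu p u -> pnorm mu p (- u) = pnorm mu p u.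
Proof. by move=> p1 pu; rewrite -scaleN1r pnormZ// normrN1 mul1r. Qed.

Lemma pnormBC p u v : (1 <= p)%E -> Lp mu p u -> Lp mu p v ->
  pnorm mu p (u - v) = pnorm mu p (v - u).
Proof. by move=> p1 pu pv; rewrite -opprB pnormN//; exact: LpB. Qed.

Lemma ler_pnormB p u v w : (1 <= p)%E -> Lp mu p u -> Lp mu p v -> Lp mu p w ->
  pnorm mu p (u - w) <= pnorm mu p (u - v) + pnorm mu p (v - w).
Proof.
move=> p1 pu pv pw; have -> : u - w = (u - v) + (v - w) by rewrite addrA subrK.
by apply: ler_pnormD => //; exact: LpB.
Qed.

Lemma ler_pnorm_sub p u v : (1 <= p)%E -> Lp mu p u -> Lp mu p v ->
  pnorm mu p (u - v) <= pnorm mu p u + pnorm mu p v.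
Proof.
move=> p1 pu pv; rewrite -(pnormN p1 pv); apply: ler_pnormD => //.
by rewrite -scaleN1r; exact: LpZ.
Qed.

Lemma ler_pnorm_dist p u v : (1 <= p)%E -> Lp mu p u -> Lp mu p v ->
  `|pnorm mu p u - pnorm mu p v| <= pnorm mu p (u - v).
Proof.
move=> p1 pu pv; rewrite ler_norml; apply/andP; split.
  rewrite lerNl opprB lerBlDr (pnormBC p1)//.
  rewrite -{1}[v](subrK u); apply: ler_pnormD => //; exact: LpB.
rewrite lerBlDr -{1}[u](subrK v); apply: ler_pnormD => //; exact: LpB.
Qed.

Lemma pnorm0 p : (1 <= p)%E -> pnorm mu p 0 = 0.
Proof. by move=> p1; rewrite -(scale0r 0) pnormZ ?normr0 ?mul0r//; exact: Lp0. Qed.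

Lemma pnorm1E f : pnorm mu 1%E f = J (fun x => `|f x|).
Proof. by rewrite /pnorm Lnorm1. Qed.

(** If the integral of the square is infinite, both sides are 0, since [fine] sends [+oo] to 0. *)
Lemma pnorm2E f : pnorm mu 2%:E f = Num.sqrt (J (fun x => f x ^+ 2)).
Proof.
rewrite /pnorm unlock /Rintegral.
under eq_integral => x _ do
  rewrite /= powR_mulrn// real_normK ?num_real//.
have : (0 <= \int[mu]_x (f x ^+ 2)%:E)%E.
  by apply: integral_ge0 => x _; rewrite lee_fin sqr_ge0.
case: (integral _ _ _) => [r r0| |] //=.
  by rewrite powR12_sqrt.
by move=> _; rewrite invr_eq0 pnatr_eq0/= sqrtr0.
Qed.

Lemma Lp2P f : Lp mu 2%:E f <->
  measurable_fun setT f /\ itg (fun x => f x ^+ 2).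
Proof.
split=> [pf|[mf /integrableP[_ f2]]].
  by split; [exact: Lp_measurable pf|exact: Lfun2_integrable_sqr].
apply/LpP; split => //; rewrite unlock poweR_lty//=.
have E x : `|f x| `^ 2 = f x ^+ 2.
  by rewrite powR_mulrn// real_normK ?num_real.
under eq_integral do rewrite E.
apply: le_lt_trans f2; apply: ge0_le_integral => //.
- by move=> x _; rewrite lee_fin sqr_ge0.
- by apply/measurable_EFinP/measurable_funX.
- by apply/measurableT_comp => //; apply/measurable_EFinP/measurable_funX.
- by move=> x _ /=; rewrite lee_fin ler_norm.
Qed.

Lemma measurable_le_set u v : measurable_fun setT u -> measurable_fun setT v ->
  measurable [set x | u x <= v x].
Proof.
move=> mu' mv.
have muv : measurable_fun setT (EFin \o (u \- v)).
  by apply/measurable_EFinP; exact: measurable_funB.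
have := emeasurable_fun_infty_c measurableT muv 0%E; rewrite setTI.
by under eq_set do rewrite /= lee_fin subr_le0.
Qed.

Lemma measurable_lt_set u v : measurable_fun setT u -> measurable_fun setT v ->
  measurable [set x | u x < v x].
Proof.
move=> mu' mv; rewrite (_ : [set _ | _] = ~` [set x | v x <= u x]).
  by apply: measurableC; exact: measurable_le_set.
by apply/seteqP; split=> x /=; [rewrite ltNge => /negP|move/negP; rewrite -ltNge].
Qed.

Lemma itgD u v : itg u -> itg v -> itg (u + v).
Proof. by move=> iu iv; apply/Lp1P/LpD => //; apply/Lp1P. Qed.

Lemma itgB u v : itg u -> itg v -> itg (u - v).
Proof. by move=> iu iv; apply/Lp1P/LpB => //; apply/Lp1P. Qed.

Lemma itgZ (a : R) u : itg u -> itg (a *: u).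
Proof. by move=> iu; apply/Lp1P/LpZ => //; apply/Lp1P. Qed.

Lemma itg_norm u : itg u -> itg (fun x => `|u x|).
Proof. exact: integrable_norm. Qed.

Lemma JD u v : itg u -> itg v -> J (u + v) = J u + J v.
Proof. by move=> iu iv; rewrite -RintegralD. Qed.

Lemma JB u v : itg u -> itg v -> J (u - v) = J u - J v.
Proof. by move=> iu iv; rewrite -RintegralB. Qed.

Lemma JZ (a : R) u : itg u -> J (a *: u) = a * J u.
Proof. by move=> iu; rewrite -RintegralZl. Qed.

Lemma ae_J u v : measurable_fun setT u -> measurable_fun setT v ->
  u = v %[ae mu] -> J u = J v.
Proof.
move=> mu' mv uv; rewrite /Rintegral; congr fine; apply: ae_eq_integral => //.
- exact/measurable_EFinP.
- exact/measurable_EFinP.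
- by apply: filterS uv => x /= /[apply] ->.
Qed.

Lemma itg_ae u v : itg u -> measurable_fun setT v -> u = v %[ae mu] -> itg v.
Proof.
move=> /integrableP[mu' iu] mv uv; apply/integrableP; split.
  exact/measurable_EFinP.
rewrite (_ : integral _ _ _ = \int[mu]_x `|(EFin \o u) x|)%E//.
apply: ge0_ae_eq_integral => //.
- by apply: measurableT_comp => //; exact/measurable_EFinP.
- exact: measurableT_comp.
- by apply: filterS uv => x /= /[apply] ->.
Qed.

Lemma ler_J u v : itg u -> itg v -> {ae mu, forall x, u x <= v x} ->
  J u <= J v.
Proof.
move=> iu iv uv.
have mu' := measurable_itg iu; have mv := measurable_itg iv.
(* [le_Rintegral] wants the inequality everywhere, so [v] is replaced by the a.e. equal maximum of
   [u] and [v]. *)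
have mm : measurable_fun setT (fun x => Num.max (u x) (v x)).
  exact: measurable_maxr.
have vE : v = (fun x => Num.max (u x) (v x)) %[ae mu].
  by apply: filterS uv => x uvx _; rewrite max_r.
rewrite (ae_J mv mm vE); apply: le_Rintegral => //.
- exact: itg_ae iv mm vE.
- by move=> x _; rewrite le_max lexx.
Qed.

Lemma le_itg u v : measurable_fun setT u -> itg v ->
  {ae mu, forall x, `|u x| <= v x} -> itg u.
Proof.
move=> mu' iv uv; have mv := measurable_itg iv.
set w := fun x => Num.max (`|u x|) (v x).
have mw : measurable_fun setT w.
  by apply: measurable_maxr => //; exact: measurableT_comp.
have iw : itg w.
  by apply: (itg_ae iv) => //; apply: filterS uv => x uvx _; rewrite /w max_r.
apply: le_integrable iw => //; first exact/measurable_EFinP.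
by move=> x _ /=; rewrite lee_fin /w (le_trans _ (ler_norm _))// le_max lexx.
Qed.


Lemma ler_norm_J u : itg u -> `|J u| <= J (fun x => `|u x|).
Proof. exact: le_normr_Rintegral. Qed.

Lemma EFin_J u : itg u -> (J u)%:E = (\int[mu]_x (u x)%:E)%E.
Proof. by move=> iu; rewrite /Rintegral fineK//; apply: integrable_fin_num. Qed.

Lemma J_norm_eq0 u : itg u -> J (fun x => `|u x|) = 0 -> u = 0 %[ae mu].
Proof.
move=> iu; rewrite /Rintegral => /eqP; rewrite -eqe fineK; last first.
  by apply: integrable_fin_num => //; exact: itg_norm.
move/eqP => J0; have := (@ae_eq_integral_abs _ _ _ mu setT measurableT
  (EFin \o u) (measurable_int mu iu)).1 J0.
by apply: filterS => x /= /[apply] -[].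
Qed.

Lemma pnorm1_eq0 u : Lp mu 1%E u -> pnorm mu 1%E u = 0 -> u = 0 %[ae mu].
Proof. by move=> /Lp1P iu; rewrite pnorm1E; exact: J_norm_eq0. Qed.

Lemma ae_pnorm1 u v : measurable_fun setT u -> measurable_fun setT v ->
  u = v %[ae mu] -> pnorm mu 1%E u = pnorm mu 1%E v.
Proof.
move=> mu' mv uv; rewrite !pnorm1E; apply: ae_J.
- exact: measurableT_comp.
- exact: measurableT_comp.
- by apply: filterS uv => x /[apply] ->.
Qed.

Lemma ae_pnorm2 u v : measurable_fun setT u -> measurable_fun setT v ->
  u = v %[ae mu] -> pnorm mu 2%:E u = pnorm mu 2%:E v.
Proof.
move=> mu' mv uv; rewrite !pnorm2E; congr Num.sqrt; apply: ae_J.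
- exact: measurable_funX.
- exact: measurable_funX.
- by apply: filterS uv => x /[apply] ->.
Qed.

Lemma operator0 p D S : (1 <= p)%E -> linear_operator mu p D S -> S 0 = 0 %[ae mu].
Proof.
move=> p1 LS; have D0 := subspace0 (operator_dom LS).
have := operatorP LS 1 D0 D0; rewrite scaler0 addr0 scale1r.
by apply: filterS => x /[apply]; rewrite !fctE => /eqP;
  rewrite -subr_eq subrr eq_sym => /eqP.
Qed.

Lemma ip_itg u v : Lp mu 2%:E u -> Lp mu 2%:E v -> itg (u \* v).
Proof. by move=> pu pv; apply/Lp1P; exact: Lfun2_mul_Lfun1. Qed.

Lemma ip_normsq u : Lp mu 2%:E u -> ip mu u u = pnorm mu 2%:E u ^+ 2.
Proof.
move=> /Lp2P[_ iu]; rewrite pnorm2E sqr_sqrtr.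
  by apply: eq_Rintegral => x _; rewrite expr2.
by apply: Rintegral_ge0 => x _; exact: sqr_ge0.
Qed.

Lemma ipC u v : ip mu u v = ip mu v u.
Proof. by apply: eq_Rintegral => x _; rewrite mulrC. Qed.

Lemma ip_linl (a : R) u v w : Lp mu 2%:E u -> Lp mu 2%:E v -> Lp mu 2%:E w ->
  ip mu (a *: u + v) w = a * ip mu u w + ip mu v w.
Proof.
move=> pu pv pw; have iuw := ip_itg pu pw; have ivw := ip_itg pv pw.
rewrite /ip -(JZ a)// -JD//; last exact: itgZ.
by apply: eq_Rintegral => x _; rewrite !fctE /= mulrDl -scalerAl.
Qed.

Lemma ipBl u v w : Lp mu 2%:E u -> Lp mu 2%:E v -> Lp mu 2%:E w ->
  ip mu (u - v) w = ip mu u w - ip mu v w.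
Proof.
by move=> pu pv pw; rewrite addrC -scaleN1r ip_linl// mulN1r addrC.
Qed.

Lemma ae_ip u u' v v' : measurable_fun setT u -> measurable_fun setT u' ->
  measurable_fun setT v -> measurable_fun setT v' ->
  u = u' %[ae mu] -> v = v' %[ae mu] -> ip mu u v = ip mu u' v'.
Proof.
move=> ? ? ? ? uu vv; apply: ae_J; try exact: measurable_funM.
by apply: filterS2 uu vv => x + + Dx => -> // -> //.
Qed.

Lemma cauchy_schwarz u v : Lp mu 2%:E u -> Lp mu 2%:E v ->
  J (fun x => `|u x * v x|) <= pnorm mu 2%:E u * pnorm mu 2%:E v.
Proof.
move=> pu pv; rewrite -lee_fin EFinM !pnorm_fin//.
have := ip_itg pu pv => /[dup] iuv /Lp1P /pnorm_fin; rewrite pnorm1E => ->.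
apply: hoelder => //; try (by apply: Lp_measurable; eassumption).
by rewrite [RHS]splitr !div1r.
Qed.

Lemma ip_bound u v : Lp mu 2%:E u -> Lp mu 2%:E v ->
  `|ip mu u v| <= pnorm mu 2%:E u * pnorm mu 2%:E v.
Proof.
move=> pu pv; apply: le_trans (cauchy_schwarz pu pv).
by apply: ler_norm_J; exact: ip_itg.
Qed.

End Lp_basics.

(** * Completeness of L1 *)

Section L1_completeness.
Context d (T : measurableType d) (R : realType).
Variable mu : {measure set T -> \bar R}.
Local Notation fn := (T -> R).
Local Notation itg f := (mu.-integrable setT (EFin \o f)).
Local Notation "'J' f" := (Rintegral mu setT f) (at level 10, f at level 9).

Lemma beppo_levi (s : nat -> fn) (C : R) : (forall n, itg (s n)) ->
  (forall n x, 0 <= s n x) -> (forall x, {homo s^~ x : n m / (n <= m)%N >-> n <= m}) ->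
  (forall n, J (s n) <= C) ->
  exists2 P, Lp mu 1%E P & pnorm mu 1%E (s n - P) @[n --> \oo] --> (0 : R).
Proof.
move=> is_ s0 nds sC.
have ms n : measurable_fun setT (EFin \o s n) by exact: measurable_int (is_ n).
have nds' x : {homo (fun n => (s n x)%:E) : n m / (n <= m)%N >-> (n <= m)%E}.
  by move=> n m nm; rewrite lee_fin nds.
have cvs x := ereal_nondecreasing_is_cvgn (nds' x).
(* This limit may be infinite; the bound on the integrals makes it finite a.e., and [fine] then
   yields a real representative. *)
pose P' x := limn (fun n => (s n x)%:E).
have mP' : measurable_fun setT P'.
  rewrite (_ : P' = fun x => limn_esup (fun n => (s n x)%:E)).
    exact: measurable_fun_limn_esup.
  by apply/funext => x; rewrite /P' is_cvg_limn_esupE.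
have sP' n x : ((s n x)%:E <= P' x)%E.
  rewrite /P' (cvg_lim _ (ereal_nondecreasing_cvgn (nds' x)))//.
  by apply: ereal_sup_ubound; exists n.
have P'0 x : (0 <= P' x)%E by apply: le_trans (sP' 0%N x); rewrite lee_fin.
have cvJ := cvg_monotone_convergence (mu := mu) measurableT ms
  (fun n x _ => s0 n x) (fun x _ => nds' x).
have JE n : (\int[mu]_x (EFin \o s n) x)%E = (J (s n))%:E.
  by rewrite EFin_J.
have iP' : mu.-integrable setT P'.
  apply/integrableP; split => //.
  under eq_integral do rewrite gee0_abs//.
  apply: (@le_lt_trans _ _ C%:E); last exact: ltry.
  rewrite -[X in (X <= _)%E](cvg_lim _ cvJ)//; apply: lime_le.
    by apply/cvg_ex; eexists; exact: cvJ.
  by apply: nearW => n; rewrite JE lee_fin.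
have finP : {ae mu, forall x, P' x = (fine (P' x))%:E}.
  by have := integrable_ae measurableT iP'; apply: filterS => x /(_ I) /fineK.
have iP : itg (fine \o P').
  apply/integrableP; split.
    by apply/measurable_EFinP; exact: measurableT_comp.
  have /integrableP[_] := iP'; apply: le_lt_trans.
  apply: ge0_le_integral => //; try by apply: measurableT_comp.
  - by apply: measurableT_comp => //; apply/measurable_EFinP; exact: measurableT_comp.
  - by move=> x _ /=; case: (P' x) => //= ; rewrite ?normr0 ?leey.
exists (fine \o P'); first exact/Lp1P.
have nE n : pnorm mu 1%E (s n - (fine \o P')) = J (fine \o P') - J (s n).
  rewrite pnorm1E -JB//; apply: ae_J.
  - by apply: measurableT_comp => //; apply/measurable_itg/itgB.
  - by apply: (@measurable_itg _ _ _ mu); exact: itgB.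
  - apply: filterS finP => x P'x _ /=; rewrite !fctE /= distrC ger0_norm// subr_ge0.
    by rewrite -lee_fin -P'x.
under eq_fun do rewrite nE.
have JP : (\int[mu]_x P' x)%E = (J (fine \o P'))%:E.
  by rewrite EFin_J//; apply: ae_eq_integral => //;
    [exact: measurable_int iP | apply: filterS finP].
rewrite -(subrr (J (fine \o P'))); apply: cvgB; first exact: cvg_cst.
apply: (@fine_cvg _ _ _ _ (fun n => (J (s n))%:E)); rewrite -JP.
by under eq_fun do rewrite -JE; exact: cvJ.
Qed.

Lemma cvg0P (u : nat -> R) :
  (forall e : R, 0 < e -> \forall n \near \oo, `|u n| <= e) ->
  u n @[n --> \oo] --> (0 : R).
Proof.
by move=> ue; apply/cvgrPdist_le => e /ue; apply: filterS => n; rewrite sub0r normrN.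
Qed.

Lemma cvg0_eventually (u : nat -> R) (e : R) : u n @[n --> \oo] --> (0 : R) ->
  0 < e -> exists n0, forall n, (n0 <= n)%N -> `|u n| <= e.
Proof.
move=> /cvgrPdist_le u0 /u0[n0 _ H]; exists n0 => n /H.
by rewrite sub0r normrN.
Qed.

Lemma le_of_cvg0 (x : R) (z : nat -> R) : (forall n, x <= z n) ->
  z n @[n --> \oo] --> (0 : R) -> x <= 0.
Proof.
move=> xz z0; rewrite leNgt; apply/negP => x0.
have x2 : 0 < x / 2 by rewrite divr_gt0.
have [n /(_ n (leqnn _))] := cvg0_eventually z0 x2.
have := xz n; have := ler_norm (z n); lra.
Qed.

Lemma cvg0_le (u v : nat -> R) : (forall n, 0 <= u n <= v n) ->
  v n @[n --> \oo] --> (0 : R) -> u n @[n --> \oo] --> (0 : R).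
Proof.
move=> uv v0; apply: (@squeeze_cvgr _ _ _ _ (cst 0) v) => //.
  exact: nearW.
exact: cvg_cst.
Qed.

(** Positive and negative parts of the increments are summed separately: each sum is monotone with
    bounded integrals, so Beppo Levi applies to both. *)
Lemma summable_telescope (g : nat -> fn) : (forall n, Lp mu 1%E (g n)) ->
  (forall n, pnorm mu 1%E (g n.+1 - g n) <= 2^-1 ^+ n) ->
  exists2 P, Lp mu 1%E P & pnorm mu 1%E (g n - P) @[n --> \oo] --> (0 : R).
Proof.
move=> pg gn.
pose pos (c : R) j x := Num.max (c * (g j.+1 x - g j x)) 0.
pose s c n x := \sum_(j < n) pos c j x.
have pos0 c j x : 0 <= pos c j x by rewrite le_max lexx orbT.
have ipos c j : `|c| = 1 -> itg (pos c j) /\ J (pos c j) <= 2^-1 ^+ j.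
  move=> c1; have ig : itg (g j.+1 - g j) by apply: itgB; exact/Lp1P.
  have le x : `|pos c j x| <= `|(g j.+1 - g j) x|.
    rewrite ger0_norm// ge_max normr_ge0 andbT.
    by rewrite (le_trans (ler_norm _))// normrM c1 mul1r.
  have mp : measurable_fun setT (pos c j).
    apply: measurable_maxr => //; apply: measurable_funM => //.
    exact: measurable_itg ig.
  have ip : itg (pos c j).
    by apply: le_itg (itg_norm ig) _ => //; exact: aeW.
  split => //; apply: le_trans (gn j); rewrite pnorm1E; apply: ler_J => //.
    exact: itg_norm.
  by apply: aeW => x; apply: le_trans (le x); exact: ler_norm.
have sS c n : s c n.+1 = s c n + pos c n.
  by apply/funext => x; rewrite /s big_ord_recr.
(* The bound is the exact value of the geometric sum of [2^-1 ^+ j] for [j < n], the form that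
   survives the induction. *)
have is_ c n : `|c| = 1 -> itg (s c n) /\ J (s c n) <= 2 - 2 * 2^-1 ^+ n.
  move=> c1; elim: n => [|n [in_ jn]].
    rewrite (_ : s c 0%N = 0); last by apply/funext => x; rewrite /s big_ord0.
    split; first exact/Lp1P/Lp0.
    by rewrite /Rintegral integral0 expr0 mulr1 subrr.
  have [ip jp] := ipos c n c1; rewrite sS; split; first exact: itgD.
  by rewrite JD// exprS; lra.
have BL c : `|c| = 1 ->
    exists2 P, Lp mu 1%E P & pnorm mu 1%E (s c n - P) @[n --> \oo] --> (0 : R).
  move=> c1; apply: (@beppo_levi _ 2).
  - by move=> n; have [] := is_ c n c1.
  - by move=> n x; exact: sumr_ge0.
  - move=> x; apply: homo_leq => //; first exact: le_trans.
    by move=> n; rewrite sS !fctE lerDl.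
  - move=> n; have [_] := is_ c n c1; move/le_trans; apply.
    by rewrite gerBl mulr_ge0// exprn_ge0.
have [P pP cP] := BL 1 (normr1 _).
have [Q pQ cQ] := BL (-1) (normrN1 _).
exists (g 0%N + P - Q); first by apply: LpB => //; exact: LpD.
(* [s 1 n] and [s (-1) n] sum the positive and negative parts of the increments. *)
have gE n : g n = g 0%N + s 1 n - s (-1) n.
  elim: n => [|n IH].
    by apply/funext => x; rewrite !fctE /= /s !big_ord0 addr0 subr0.
  apply/funext => x; rewrite !sS; have /(congr1 (fun f : fn => f x)) := IH.
  rewrite !fctE /= /pos mul1r mulN1r => gnx.
  set a := g n.+1 x - g n x; have -> : g n.+1 x = g n x + a by rewrite /a; ring.
  rewrite {1}gnx; case: (leP 0 a) => a0.
    by rewrite (@max_r _ _ (- a)) ?oppr_le0//; ring.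
  by rewrite (@max_l _ _ (- a)) ?oppr_ge0 ?ltW//; ring.
have ps c n : `|c| = 1 -> Lp mu 1%E (s c n).
  by move=> c1; apply/Lp1P; have [] := is_ c n c1.
apply: cvg0_le (_ : (pnorm mu 1%E (s 1 n - P) + pnorm mu 1%E (s (-1) n - Q)) @[n -->
  \oo] --> 0); last first.
  by rewrite -[X in _ --> X]addr0; exact: cvgD.
move=> n; rewrite pnorm_ge0 /= (gE n).
have -> : g 0%N + s 1 n - s (-1) n - (g 0%N + P - Q) =
  (s 1 n - P) - (s (-1) n - Q) by apply/funext => x; rewrite !fctE /=; ring.
by apply: ler_pnorm_sub => //; apply: LpB => //; apply: ps; rewrite ?normrN1 ?normr1.
Qed.

Lemma L1_complete (h : nat -> fn) : (forall n, Lp mu 1%E (h n)) ->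
  (forall e : R, 0 < e -> exists n0, forall m n, (n0 <= m)%N -> (n0 <= n)%N ->
     pnorm mu 1%E (h m - h n) <= e) ->
  exists2 P, Lp mu 1%E P & pnorm mu 1%E (h n - P) @[n --> \oo] --> (0 : R).
Proof.
move=> ph hC.
have h2 j : 0 < (2^-1 : R) ^+ j by rewrite exprn_gt0.
have /choice[k0 k0P] := fun j => hC _ (h2 j).
(* Adding up the thresholds makes the extracted indices nondecreasing while keeping [k j] above
   [k0 j]. *)
pose k j := (\sum_(i < j.+1) k0 i)%N.
have k0k j : (k0 j <= k j)%N by rewrite /k big_ord_recr leq_addl.
have kS j : (k j <= k j.+1)%N by rewrite /k [leqRHS]big_ord_recr leq_addr.
have [|P pP cP] := @summable_telescope (h \o k) (fun n => ph _).
  by move=> n; apply: k0P => //; exact: leq_trans (kS n).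
exists P => //; apply: cvg0P => e e0.
have e2 : 0 < e / 2 by rewrite divr_gt0.
have [n0 n0P] := hC _ e2.
have /cvgrPdist_le/(_ _ e2)[j1 _ j1P] := cP.
have [j2 j2P] : exists j, 2^-1 ^+ j <= e / 2.
  have half1 : `|2^-1 : R| < 1 by rewrite ger0_norm// invf_lt1// ltr1n.
  have /cvgrPdist_le/(_ _ e2)[j _ /(_ j (leqnn _))] := cvg_expr half1.
  rewrite sub0r normrN => jP; exists j.
  by apply: le_trans jP; exact: ler_norm.
pose j := maxn j1 j2; exists (k0 j) => // n /= nk.
rewrite ger0_norm ?pnorm_ge0//.
apply: le_trans (ler_pnormB _ (ph n) (ph (k j)) pP) _ => //.
rewrite [leRHS]splitr; apply: lerD.
  apply: le_trans j2P; apply: le_trans (k0P j _ _ nk (k0k j)) _.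
  by apply: ler_wiXn2l; rewrite ?leq_maxr// ?invf_le1// ?ler1n.
have := j1P j (leq_maxl _ _); rewrite sub0r normrN ger0_norm ?pnorm_ge0//.
Qed.

End L1_completeness.

(** * Uniqueness of Bochner integrals *)

Section Bochner.
Context d (T : measurableType d) (R : realType).
Variable mu : {measure set T -> \bar R}.
Local Notation fn := (T -> R).
Local Notation itg f := (mu.-integrable setT (EFin \o f)).
Local Notation "'J' f" := (Rintegral mu setT f) (at level 10, f at level 9).
Local Notation leb := (@lebesgue_measure R).
Implicit Types (s : simple_fun T R) (phi : fn).

Lemma simple_on_cons M Bx s : simple_on mu M (Bx :: s) <->
  [/\ measurable Bx.1, Bx.1 `<=` `]0, M] & Lp mu 1%E Bx.2] /\ simple_on mu M s.
Proof.
split=> [H|[H1 H2] b].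
  split; first by have := H ord0; rewrite /= (tnth_nth Bx).
  move=> b; have := H (lift ord0 b).
  by rewrite !(tnth_nth Bx) /=.
by rewrite (tnth_nth Bx) /=; case: b => -[|b] //= bs;
  have := H2 (Ordinal (bs : (b < size s)%N)); rewrite (tnth_nth Bx).
Qed.

Definition pairing phi (u : fn) : R := J (u \* phi).

Definition bounded_by1 phi := measurable_fun setT phi /\ forall x, `|phi x| <= 1.

Lemma indic_bounded_by1 (F : set T) : measurable F -> bounded_by1 (\1_F : fn).
Proof.
move=> mF; split; first exact: measurable_indic.
by move=> x; rewrite indicE normr_nat lern1 leq_b1.
Qed.

Lemma pairing_itg phi u : bounded_by1 phi -> Lp mu 1%E u -> itg (u \* phi).
Proof.
move=> [mphi phi1] /Lp1P iu; apply: le_itg (itg_norm iu) _.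
  by apply: measurable_funM => //; exact: measurable_itg iu.
by apply: aeW => x /=; rewrite normrM ler_piMr.
Qed.

Lemma pairing_lin phi (a : R) u v : bounded_by1 phi -> Lp mu 1%E u ->
  Lp mu 1%E v -> pairing phi (a *: u + v) = a * pairing phi u + pairing phi v.
Proof.
move=> b1 pu pv; have iu := pairing_itg b1 pu; have iv := pairing_itg b1 pv.
rewrite /pairing -(JZ a)// -JD//; last exact: itgZ.
by apply: eq_Rintegral => x _; rewrite !fctE /= mulrDl -scalerAl.
Qed.

Lemma pairing_bound phi u : bounded_by1 phi -> Lp mu 1%E u ->
  `|pairing phi u| <= pnorm mu 1%E u.
Proof.
move=> b1 pu; have iu := pairing_itg b1 pu; have [_ phi1] := b1.
apply: le_trans (ler_norm_J iu) _; rewrite pnorm1E; apply: ler_J.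
- exact: itg_norm.
- by apply: itg_norm; exact/Lp1P.
- by apply: aeW => x /=; rewrite normrM ler_piMr.
Qed.

(** The sign is an optimal test function, so an L1 norm becomes a single scalar pairing. *)
Lemma pairing_sg u : Lp mu 1%E u ->
  bounded_by1 (fun x => Num.sg (u x)) /\
  pairing (fun x => Num.sg (u x)) u = pnorm mu 1%E u.
Proof.
move=> pu; split.
  split; last by move=> x; rewrite normr_sg lern1 leq_b1.
  have mu' := Lp_measurable pu.
  rewrite (_ : (fun _ => _) = (fun x => (\1_[set x | 0 < u x] x - \1_[set x | u x <
    0] x))).
    by apply: measurable_funB; apply: measurable_indic; exact: measurable_lt_set.
  apply/funext => x; rewrite !indicE; case: (sgrP (u x)) => ux.
  - by rewrite !memNset ?subrr//= ?ux ltxx.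
  - by rewrite mem_set// memNset ?subr0//= => /(lt_trans ux); rewrite ltxx.
  - by rewrite memNset ?mem_set ?sub0r//= => /(lt_trans ux); rewrite ltxx.
by rewrite pnorm1E; apply: eq_Rintegral => x _ /=; rewrite mulrC -normrEsg.
Qed.

Lemma simple_val_cons Bx s t :
  simple_val (Bx :: s) t = \1_(Bx.1) t *: Bx.2 + simple_val s t.
Proof. by rewrite /simple_val big_cons. Qed.

Lemma simple_integral_cons Bx s :
  simple_integral (Bx :: s) = fine (leb Bx.1) *: Bx.2 + simple_integral s.
Proof. by rewrite /simple_integral big_cons. Qed.

Lemma simple_val_nil t : simple_val [::] t = 0 :> fn.
Proof. by rewrite /simple_val big_nil. Qed.

Lemma simple_integral_nil : simple_integral [::] = 0 :> fn.
Proof. by rewrite /simple_integral big_nil. Qed.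

Lemma Lp_simple M s : simple_on mu M s ->
  Lp mu 1%E (simple_integral s) /\ forall t, Lp mu 1%E (simple_val s t).
Proof.
elim: s => [_|Bx s IH /simple_on_cons[[_ _ pB] /IH[pi pv]]].
  by rewrite simple_integral_nil; split=> [|t]; rewrite ?simple_val_nil; exact: Lp0.
by rewrite simple_integral_cons; split=> [|t]; rewrite ?simple_val_cons; exact: Lp_lin.
Qed.

Lemma pairing0 phi : pairing phi 0 = 0.
Proof.
by rewrite /pairing /Rintegral integral0_eq// => x _ /=; rewrite mul0r.
Qed.

(** For a step function with finitely many values, exchanging the two integrations is mere
    linearity. *)
Lemma pairing_simple_integral M s phi : simple_on mu M s -> bounded_by1 phi ->
  leb.-integrable `]0, M] (EFin \o (fun t => pairing phi (simple_val s t))) /\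
  pairing phi (simple_integral s) =
    \int[leb]_(t in `]0, M]) pairing phi (simple_val s t).
Proof.
move=> + b1; elim: s => [_|Bx s IH /[dup] /Lp_simple[ps pv] /simple_on_cons[[mB BM
  pB] sM]].
  have -> : (fun t => pairing phi (simple_val [::] t)) = cst 0.
    by apply/funext => t; rewrite simple_val_nil pairing0.
  rewrite simple_integral_nil.
  by split; [exact: integrable0|rewrite pairing0 Rintegral_cst// mul0r].
have [{}IH1 IH2] := IH sM; have [{}ps {}pv] := Lp_simple sM.
have -> : (fun t => pairing phi (simple_val (Bx :: s) t)) =
    (fun t => \1_(Bx.1) t * pairing phi Bx.2 + pairing phi (simple_val s t)).
  by apply/funext => t; rewrite simple_val_cons pairing_lin.
have lebM : (leb `]0%R, M] < +oo)%E.
  by rewrite lebesgue_measure_itv/=; case: ifP => _; rewrite ltry.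
have i1 : leb.-integrable `]0, M] (EFin \o \1_(Bx.1)).
  apply: measurable_bounded_integrable => //.
  exists 1; split; first exact: num_real.
  by move=> x x1 y _; rewrite /= indicE normr_nat (le_trans _ (ltW x1))// lern1 leq_b1.
have iB : leb.-integrable `]0, M] (EFin \o (fun t => \1_(Bx.1) t * pairing phi Bx.2)).
  rewrite (_ : _ \o _ = (fun t => (pairing phi Bx.2)%:E * (EFin \o \1_(Bx.1)) t)%E).
    exact: integrableZl.
  by apply/funext => t /=; rewrite EFinM muleC.
split.
  have /(_ (measurable_itv _)) := fun m => integrableD m iB IH1.
  by apply: eq_integrable.
rewrite RintegralD// simple_integral_cons pairing_lin// IH2; congr (_ + _).
rewrite RintegralZr//.
congr (_ * _); rewrite /Rintegral integral_indic//; congr (fine (leb _)).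
by rewrite setIidl.
Qed.

Definition step_error (F : R -> fn) M s : \bar R :=
  (\int[leb]_(t in `]0%R, M]) (pnorm mu 1%E (F t - simple_val s t))%:E)%E.

(* Pairing the difference of the two integrals with its sign reduces the claim to
   scalar integrals over ]0, M], so that no Fubini theorem is needed. *)
Lemma simple_integral_dist (F : R -> fn) M s1 s2 :
  (forall t, 0 < t -> Lp mu 1%E (F t)) ->
  simple_on mu M s1 -> simple_on mu M s2 ->
  measurable_fun `]0, M] (fun t => pnorm mu 1%E (F t - simple_val s1 t)) ->
  measurable_fun `]0, M] (fun t => pnorm mu 1%E (F t - simple_val s2 t)) ->
  ((pnorm mu 1%E (simple_integral s1 - simple_integral s2))%:E <=
    step_error F M s1 + step_error F M s2)%E.
Proof.
move=> pF so1 so2 m1 m2.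
have [p1 pv1] := Lp_simple so1; have [p2 pv2] := Lp_simple so2.
set h := _ - _; have ph : Lp mu 1%E h by exact: LpB.
have [b1 <-] := pairing_sg ph; set phi := (fun x => Num.sg _) in b1 *.
have [i1 e1] := pairing_simple_integral so1 b1.
have [i2 e2] := pairing_simple_integral so2 b1.
have pB u v : Lp mu 1%E u -> Lp mu 1%E v ->
    pairing phi (u - v) = pairing phi u - pairing phi v.
  by move=> pu pv; rewrite addrC -scaleN1r pairing_lin// mulN1r addrC.
rewrite /h pB// e1 e2 -RintegralB//.
apply: (@le_trans _ _ (`|\int[leb]_(t in `]0, M])
  (pairing phi (simple_val s1 t) - pairing phi (simple_val s2 t))|%:E)).
  by rewrite lee_fin ler_norm.
have iB : leb.-integrable `]0, M] (EFin \o (fun t =>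
    pairing phi (simple_val s1 t) - pairing phi (simple_val s2 t))).
  have /(_ (measurable_itv _)) := fun m => integrableB m i1 i2.
  by apply: eq_integrable.
rewrite EFin_normr_Rintegral//; apply: le_trans (le_abse_integral _ _ _) _ => //.
  exact: measurable_int iB.
rewrite /step_error -ge0_integralD//; last 4 first.
- by move=> t _; rewrite lee_fin pnorm_ge0.
- exact/measurable_EFinP.
- by move=> t _; rewrite lee_fin pnorm_ge0.
- exact/measurable_EFinP.
apply: ge0_le_integral => //.
- by apply: measurableT_comp => //; exact: measurable_int iB.
- by apply: emeasurable_funD; exact/measurable_EFinP.
- move=> t; rewrite /= in_itv/= => /andP[t0 _].
rewrite -EFinD lee_fin -pB//.
apply: le_trans (pairing_bound b1 _) _; first exact: LpB.
rewrite (pnormBC _ (pF t t0) (pv1 t))//.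
by apply: ler_pnormB => //; exact: pF.
Qed.

(** [bochner_integral] is an arbitrary choice among the Bochner integrals; uniqueness identifies it
    a.e. with the limit of Riemann sums. Both candidates are limits of simple integrals whose
    distance is at most the sum of two vanishing step errors. *)
Lemma bochner_integral_unique (F : R -> fn) M h h' :
  (forall t, 0 < t -> Lp mu 1%E (F t)) ->
  is_bochner_integral mu F M h -> is_bochner_integral mu F M h' ->
  h = h' %[ae mu].
Proof.
move=> pF [ph [s [so ms es hs]]] [ph' [s' [so' ms' es' hs']]].
have pB : Lp mu 1%E (h - h') by exact: LpB.
suff N0 : pnorm mu 1%E (h - h') = 0.
  have := pnorm1_eq0 pB N0; apply: filterS => x /[apply].
  by rewrite !fctE => /eqP; rewrite subr_eq0 => /eqP.
apply/eqP; rewrite eq_le pnorm_ge0 andbT -lee_fin.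
have ps n : Lp mu 1%E (simple_integral (s n)) by have [] := Lp_simple (so n).
have ps' n : Lp mu 1%E (simple_integral (s' n)) by have [] := Lp_simple (so' n).
pose a n := ((pnorm mu 1%E (simple_integral (s n) - h))%:E +
   (step_error F M (s n) + step_error F M (s' n)) +
   (pnorm mu 1%E (simple_integral (s' n) - h'))%:E)%E.
have a0 : a n @[n --> \oo] --> 0%E.
  rewrite -[X in _ --> X]adde0; apply: cvgeD => //.
    rewrite -[X in _ --> X]adde0; apply: cvgeD => //.
      by apply: cvg_EFin; [exact: nearW|exact: hs].
    by rewrite -[X in _ --> X]adde0; apply: cvgeD.
  by apply: cvg_EFin; [exact: nearW|exact: hs'].
rewrite -[X in (_ <= X)%E](cvg_lim _ a0)//; apply: lime_ge.
  by apply/cvg_ex; exists 0%E.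
apply: nearW => n.
have := simple_integral_dist pF (so n) (so' n) (ms n) (ms' n).
have e0 q : (0 <= step_error F M q)%E.
  by apply: integral_ge0 => t _; rewrite lee_fin pnorm_ge0.
move=> dist; apply: (@le_trans _ _ ((pnorm mu 1%E (simple_integral (s n) - h))%:E +
   (pnorm mu 1%E (simple_integral (s n) - simple_integral (s' n)))%:E +
   (pnorm mu 1%E (simple_integral (s' n) - h'))%:E)%E).
  rewrite -!EFinD lee_fin.
  rewrite (pnormBC _ (ps n) ph)//.
  apply: le_trans (ler_pnormB _ ph (ps' n) ph') _ => //; rewrite lerD2r.
  exact: ler_pnormB.
by apply: leeD => //; apply: leeD.
Qed.

End Bochner.

(** * Strong continuity on L1 *)

Section L1_semigroup.
Context d (T : measurableType d) (R : realType).
Variable mu : {measure set T -> \bar R}.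
Local Notation fn := (T -> R).
Local Notation itg f := (mu.-integrable setT (EFin \o f)).
Local Notation "'J' f" := (Rintegral mu setT f) (at level 10, f at level 9).
Implicit Types (f g u : fn) (t : R).

Lemma level_set_finite f (c : R) : itg f -> 0 < c ->
  measurable [set x | c <= `|f x|] /\ (mu [set x | (c <= `|f x|)%R] < +oo)%E.
Proof.
move=> /[dup] /measurable_itg mf /integrableP[mEf f_fin] c0.
have mA : measurable [set x | c <= `|f x|].
  by apply: measurable_le_set => //; exact: measurableT_comp.
split => //.
have := @le_integral_comp_abse _ _ _ mu _ measurableT (EFin \o f) c id
  (@measurable_id _ _ _) (fun _ h => h) (fun x y _ _ h => h) mEf c0.
rewrite setTI /= => /le_lt_trans/(_ f_fin).
rewrite (_ : [set x | _] = [set x | c <= `|f x|]); last first.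
  by apply/seteqP; split=> x /=; rewrite lee_fin.
move=> h; rewrite ltNge leye_eq; apply/negP => /eqP muoo.
by move: h; rewrite muoo muleC mulyr gtr0_sg// mul1e ltxx.
Qed.

Lemma L1_truncation f (e : R) : Lp mu 1%E f -> 0 < e ->
  exists2 g, Lp mu 1%E g /\ Lp mu 2%:E g &
    pnorm mu 1%E (f - g) <= e /\
    exists2 F, measurable F /\ (mu F < +oo)%E & forall x, ~ F x -> g x = 0.
Proof.
move=> /[dup] pf /Lp1P itf e0; have mf := measurable_itg itf.
(* The lower cut makes [F n] of finite measure; the upper cut bounds the square of [g n] by
   [n.+1 * |f|], which puts [g n] in L2. *)
pose F n := [set x | n.+1%:R^-1 <= `|f x|] `&` [set x | `|f x| <= n.+1%:R].
have mF n : measurable (F n).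
  by apply: measurableI; apply: measurable_le_set => //; exact: measurableT_comp.
pose g n : fn := f \* \1_(F n).
have mg n : measurable_fun setT (g n).
  by apply: measurable_funM => //; exact: measurable_indic.
have gf n x : `|f x - g n x| <= `|f x|.
  by rewrite /g /= indicE; case: (_ \in _); rewrite ?mulr1 ?mulr0 ?subrr ?subr0 ?normr0.
have gf' n x : `|g n x| <= `|f x|.
  by rewrite /g /= indicE; case: (_ \in _); rewrite ?mulr1 ?mulr0 ?normr0.
have pg n : Lp mu 1%E (g n).
  by apply/Lp1P; apply: le_itg (itg_norm itf) _ => //; exact: aeW.
have g2 n : Lp mu 2%:E (g n).
  apply/Lp2P; split => //.
  apply: (@le_itg _ _ _ _ _ (n.+1%:R *: (fun x => `|f x|))).
  - exact: measurable_funX.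
  - exact/itgZ/itg_norm.
  apply: aeW => x; rewrite normrX expr2 ler_pM// /g /= indicE.
  have [/set_mem[_ /= ?]|_] := boolP (x \in F n); first by rewrite mulr1.
  by rewrite mulr0 normr0.
have cg : pnorm mu 1%E (f - g n) @[n --> \oo] --> (0 : R).
  have [|||||_ + _] := @dominated_convergence _ _ _ mu _ measurableT
    (fun n => EFin \o (f - g n)) (cst 0%E) (EFin \o (fun x => `|f x|)).
  - by move=> n; apply/measurable_EFinP; exact: measurable_funB.
  - exact: measurable_cst.
  - apply: aeW => x _; apply: cvg_EFin; first exact: nearW.
    apply: cvg_near_cst.
    have [fx0|fx0] := eqVneq (f x) 0.
      by apply: nearW => n; rewrite !fctE /= /g /= fx0 mul0r subr0.
    (* From this index on, [n.+1] exceeds both [|f x|] and its inverse, so [x] lies in [F n] and the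
       error at [x] is exactly 0. *)
    pose n0 := (Num.truncn (`|f x|) + Num.truncn (`|f x|^-1))%N.
    exists n0 => // n /= n0n.
    rewrite !fctE /= /g /= indicE mem_set ?mulr1 ?subrr//; split => /=.
      rewrite invf_ple ?posrE ?normr_gt0//.
      apply: le_trans (ltW (truncnS_gt _)) _.
      by rewrite ler_nat ltnS (leq_trans _ n0n)// leq_addl.
    apply: le_trans (ltW (truncnS_gt _)) _.
    by rewrite ler_nat ltnS (leq_trans _ n0n)// leq_addr.
  - exact: itg_norm.
  - by apply: aeW => x n _; rewrite /= lee_fin; exact: gf.
  move=> cv; apply: (@fine_cvg _ _ _ _ (fun n => (pnorm mu 1%E (f - g n))%:E)).
  have E n : (pnorm mu 1%E (f - g n))%:E =
      (\int[mu]_x `|(EFin \o (f - g n)%R) x - cst 0%R x|)%E.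
    rewrite pnorm1E EFin_J; last exact/itg_norm/itgB/Lp1P.
    by apply: eq_integral => x _ /=; rewrite subr0.
  by under eq_fun do rewrite E; exact: cv.
have [n /(_ n (leqnn _))] := cvg0_eventually cg e0.
rewrite ger0_norm ?pnorm_ge0// => ne.
exists (g n) => //; split => //; exists (F n); last first.
  by move=> x Fx; rewrite /g /= indicE memNset// mulr0.
split => //; have n0 : (0 : R) < n.+1%:R^-1 by rewrite invr_gt0.
have [mA Afin] := level_set_finite itf n0.
by apply: le_lt_trans Afin; apply: le_measure; rewrite ?inE//; exact: subIsetl.
Qed.

Variable U : R -> fn -> fn.
Hypothesis CU : C0_contraction_semigroup mu U.
Hypothesis LU : L1_extension mu U.

Lemma semigroup_Lp1 t f : 0 < t -> Lp mu 1%E f -> Lp mu 1%E (U t f).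
Proof. by move=> t0; have /operator_Lp := L1_operator LU t0; apply. Qed.

Lemma semigroup_Lp2 t f : 0 < t -> Lp mu 2%:E f -> Lp mu 2%:E (U t f).
Proof.
by move=> t0; have [CU1 _] := CU; have /operator_Lp := semigroup_operator CU1 t0; apply.
Qed.

Lemma semigroup_lin1 t (a : R) f g : 0 < t -> Lp mu 1%E f -> Lp mu 1%E g ->
  U t (a *: f + g) = a *: U t f + U t g %[ae mu].
Proof. by move=> t0 pf pg; have /operatorP := L1_operator LU t0; apply. Qed.

Lemma semigroupB1 t f g : 0 < t -> Lp mu 1%E f -> Lp mu 1%E g ->
  U t (f - g) = U t f - U t g %[ae mu].
Proof.
move=> t0 pf pg; have := semigroup_lin1 (-1) t0 pg pf.
rewrite !scaleN1r [- g + f]addrC; apply: filterS => x /[apply] ->.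
by rewrite addrC.
Qed.

Lemma semigroup_dist1 t f g : 0 < t -> Lp mu 1%E f -> Lp mu 1%E g ->
  pnorm mu 1%E (U t f - U t g) <= pnorm mu 1%E (f - g).
Proof.
move=> t0 pf pg; have pfg : Lp mu 1%E (f - g) by exact: LpB.
apply: le_trans (L1_contraction LU t0 pfg).
rewrite le_eqVlt; apply/orP; left; apply/eqP/esym/ae_pnorm1.
- exact: Lp_measurable (semigroup_Lp1 t0 pfg).
- by apply: measurable_funB; apply: Lp_measurable (semigroup_Lp1 t0 _); eassumption.
- exact: semigroupB1.
Qed.

Lemma semigroup_le t f g : 0 < t -> Lp mu 1%E f -> Lp mu 1%E g ->
  {ae mu, forall x, f x <= g x} -> {ae mu, forall x, U t f x <= U t g x}.
Proof.
move=> t0 pf pg fg; have pgf : Lp mu 1%E (g - f) by exact: LpB.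
have : ae_nonneg mu (U t (g - f)).
  apply: L1_positive => //.
  by apply: filterS fg => x; rewrite !fctE subr_ge0.
apply: filterS2 (semigroupB1 t0 pg pf) => x /(_ I) ->.
by rewrite !fctE subr_ge0.
Qed.

Lemma indic_Lp2 F : measurable F -> (mu F < +oo)%E -> Lp mu 2%:E (\1_F : fn).
Proof.
move=> mF Ffin; apply/Lp2P; split; first exact: measurable_indic.
rewrite (_ : (fun _ => _) = \1_F); last first.
  by apply/funext => x; rewrite indicE; case: (_ \in _); rewrite ?expr1n// expr0n.
apply/integrableP; split; first exact/measurable_EFinP/measurable_indic.
under eq_integral => x _ do rewrite /= ger0_norm//.
by rewrite integral_indic// setIT.
Qed.

(** [L1_extension] gives contractivity but states no continuity in time. This is recovered from L2:
    on a set of finite measure Cauchy-Schwarz turns L2 into L1 convergence, and contractivity keeps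
    mass from escaping that set. *)
Lemma semigroup_continuous0 f (e : R) : Lp mu 1%E f -> 0 < e ->
  exists2 delta : R, 0 < delta &
    forall t, 0 < t -> t < delta -> pnorm mu 1%E (U t f - f) <= e.
Proof.
move=> pf e0; have e4 : 0 < e / 4 by rewrite divr_gt0.
have [g [pg1 pg2] [fg [F [mF Ffin] gF]]] := L1_truncation pf e4.
have p1F := indic_Lp2 mF Ffin.
set c := pnorm mu 2%:E (\1_F : fn); have c0 : 0 <= c by exact: pnorm_ge0.
have bnd t : 0 < t ->
    pnorm mu 1%E (U t g - g) <= 2 * (pnorm mu 2%:E (U t g - g) * c).
  move=> t0; have pD1 : Lp mu 1%E (U t g - g) by apply: LpB => //; exact: semigroup_Lp1.
  have pD2 : Lp mu 2%:E (U t g - g).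
    by apply: LpB => //; [exact: lee1n|exact: semigroup_Lp2].
  have iDF := ip_itg pD2 p1F.
  have iU : itg (fun x => `|U t g x|) by apply/itg_norm/Lp1P/semigroup_Lp1.
  have ig : itg (fun x => `|g x|) by apply/itg_norm/Lp1P.
  have CS := cauchy_schwarz pD2 p1F; rewrite -/c in CS.
  have := L1_contraction LU t0 pg1; rewrite !pnorm1E => Ug.
  (* As [g] vanishes off [F], [|U t g - g| <= 2 |U t g - g| 1_F + |U t g| - |g|]
     everywhere, and the contraction property disposes of the last two terms. *)
  apply: (@le_trans _ _ (J (2 *: (fun x => `|(U t g - g) x * \1_F x|) +
     ((fun x => `|U t g x|) - (fun x => `|g x|))))).
    apply: ler_J; first exact/itg_norm/Lp1P.
      by apply: itgD; [exact/itgZ/itg_norm|exact: itgB].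
    apply: aeW => x; rewrite !fctE /= indicE; have [Fx|Fx] := pselect (F x).
      rewrite mem_set// mulr1; have := ler_normB (U t g x) (U t g x - g x).
      rewrite opprB addrCA subrr addr0 => h.
      by rewrite (_ : 2 *: _ = 2 * `|U t g x - g x|)//; lra.
    by rewrite memNset// gF// mulr0 normr0 scaler0 !subr0 add0r.
  rewrite JD ?JZ ?JB//; [|exact: itg_norm|exact/itgZ/itg_norm|exact: itgB].
  rewrite -[leRHS]addr0; apply: lerD; first by rewrite ler_pM2l.
  by rewrite subr_le0.
have [CU1 _] := CU; have := semigroup_continuous CU1 pg2.
(* The errors add up to [e / 4 + 2 * (e / 4) + e / 4]; [c + 1] guards against [c = 0]. *)
pose e' := e / (4 * (c + 1)); have e'0 : 0 < e' by rewrite divr_gt0// mulr_gt0//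
  ltr_wpDl.
move=> /cvgrPdist_le/(_ e' e'0)[delta /= delta0 Hd].
exists delta => // t t0 td.
have := Hd t; rewrite /= sub0r normrN gtr0_norm// => /(_ td t0).
rewrite sub0r normrN ger0_norm ?pnorm_ge0// => Hg.
have pUf := semigroup_Lp1 t0 pf; have pUg := semigroup_Lp1 t0 pg1.
apply: le_trans (ler_pnormB _ pUf pUg pf) _ => //.
apply: le_trans (lerD (semigroup_dist1 t0 pf pg1) (ler_pnormB _ pUg pg1 pf)) _ => //.
rewrite (pnormBC _ pg1 pf)//.
have h1 : pnorm mu 2%:E (U t g - g) * c <= e / 4.
  apply: (@le_trans _ _ (e' * (c + 1))).
    by apply: ler_pM => //; [exact: pnorm_ge0|rewrite lerDl].
  rewrite /e' -mulrA invfM -mulrA mulVf ?mulr1//.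
  by rewrite gt_eqF// ltr_wpDl.
have := bnd t t0; lra.
Qed.

Lemma semigroup_time_dist t t' f : 0 < t -> t < t' -> Lp mu 1%E f ->
  pnorm mu 1%E (U t' f - U t f) <= pnorm mu 1%E (U (t' - t) f - f).
Proof.
move=> t0 tt' pf; have s0 : 0 < t' - t by rewrite subr_gt0.
have pU := semigroup_Lp1 s0 pf.
apply: le_trans (semigroup_dist1 t0 pU pf).
rewrite le_eqVlt; apply/orP; left; apply/eqP/ae_pnorm1.
- by apply: measurable_funB; apply: Lp_measurable (semigroup_Lp1 _ pf);
    rewrite // (lt_trans t0).
- apply: measurable_funB; apply: Lp_measurable.
    exact: semigroup_Lp1 t0 pU.
  exact: semigroup_Lp1 t0 pf.
- have := L1_semigroup LU t0 s0 pf; rewrite addrC subrK.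
  by apply: filterS => x /[apply]; rewrite !fctE => ->.
Qed.

(** By the semigroup law and contractivity the distance is controlled by the gap between the times
    alone, so [delta] is uniform over all positive times. *)
Lemma semigroup_modulus f (e : R) : Lp mu 1%E f -> 0 < e ->
  exists2 delta : R, 0 < delta &
    forall t t', 0 < t -> 0 < t' -> `|t - t'| < delta ->
      pnorm mu 1%E (U t f - U t' f) <= e.
Proof.
move=> pf e0; have [delta d0 H] := semigroup_continuous0 pf e0.
exists delta => // t t' t0 t'0 tt'.
have pU := semigroup_Lp1 t0 pf; have pU' := semigroup_Lp1 t'0 pf.
have [lt|lt|->] := ltgtP t t'; last by rewrite subrr pnorm0// ltW.
  rewrite (pnormBC _ pU pU')//; apply: le_trans (semigroup_time_dist t0 lt pf) _.
  by apply: H; rewrite ?subr_gt0//; move: tt'; rewrite distrC gtr0_norm ?subr_gt0.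
apply: le_trans (semigroup_time_dist t'0 lt pf) _.
by apply: H; rewrite ?subr_gt0//; move: tt'; rewrite gtr0_norm ?subr_gt0.
Qed.

End L1_semigroup.

(** * Riemann sums of an orbit *)

Section Riemann.
Context d (T : measurableType d) (R : realType).
Variable mu : {measure set T -> \bar R}.
Local Notation fn := (T -> R).
Local Notation leb := (@lebesgue_measure R).
Implicit Types (f g u : fn) (t : R) (n m k : nat).

Variable U : R -> fn -> fn.
Hypothesis CU : C0_contraction_semigroup mu U.
Hypothesis LU : L1_extension mu U.

(** Dyadic meshes are nested: a node stays a node of every finer mesh, so a shift by a dyadic time
    maps Riemann sums to pieces of Riemann sums. *)
Definition mesh m : R := 2^-1 ^+ m.

Lemma mesh_gt0 m : 0 < mesh m.
Proof. by rewrite exprn_gt0. Qed.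

Lemma mesh_node n m : (n * 2 ^ m)%:R * mesh m = n%:R.
Proof.
by rewrite /mesh natrM natrX -mulrA -exprMn mulfV ?expr1n ?mulr1// pnatr_eq0.
Qed.

Lemma node_gt0 k m : 0 < k.+1%:R * mesh m.
Proof. by rewrite mulr_gt0// mesh_gt0. Qed.

Lemma cvg_mesh (F : R -> R) : F t @[t --> (0 : R)^'+] --> (0 : R) ->
  F (mesh m) @[m --> \oo] --> (0 : R).
Proof.
move=> F0; apply: cvg0P => e e0.
have /cvgrPdist_le/(_ e e0)[dl /= dl0 H] := F0.
have dl2 : 0 < dl / 2 by rewrite divr_gt0.
have half1 : `|2^-1 : R| < 1 by rewrite ger0_norm// invf_lt1// ltr1n.
have [m0 Hm0] := cvg0_eventually (cvg_expr half1) dl2.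
exists m0 => // m /= /Hm0 dm.
have := H (mesh m); rewrite /= sub0r normrN => /(_ _ (mesh_gt0 m)).
rewrite sub0r normrN; apply; apply: le_lt_trans dm _.
by rewrite gtr_pMr// invf_lt1// ltr1n.
Qed.

(* Right endpoints are used because [U t] is meaningful for [t > 0] only. *)
Definition riemann_sum n m f : fn :=
  \sum_(k < n * 2 ^ m) mesh m *: U (k.+1%:R * mesh m) f.

Definition riemann_step n m f : simple_fun T R :=
  [seq (`]k%:R * mesh m, k.+1%:R * mesh m]%classic, U (k.+1%:R * mesh m) f)
     | k <- iota 0 (n * 2 ^ m)].

Lemma simple_integral_step n m f :
  simple_integral (riemann_step n m f) = riemann_sum n m f.
Proof.
rewrite /simple_integral /riemann_step big_map.
have -> : iota 0 (n * 2 ^ m) = index_iota 0 (n * 2 ^ m) by rewrite /index_iota subn0.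
rewrite big_mkord.
apply: eq_bigr => k _ /=; congr (_ *: _).
rewrite lebesgue_measure_itv/= lte_fin ltr_pM2r ?mesh_gt0// ltr_nat ltnSn.
by rewrite -EFinB /= -mulrBl -natrB// subSnn mul1r.
Qed.

Lemma simple_on_step n m f : Lp mu 1%E f -> simple_on mu n%:R (riemann_step n m f).
Proof.
move=> pf b; set x0 : set R * fn := (set0, 0).
rewrite (tnth_nth x0) /=; case: b => b /=; rewrite size_map size_iota => bs.
rewrite (nth_map 0%N) ?size_iota// nth_iota// add0n /=; split => //.
  move=> t /=; rewrite !in_itv/= => /andP[t1 t2]; apply/andP; split.
    by apply: le_lt_trans t1; rewrite mulr_ge0// ltW// mesh_gt0.
  apply: le_trans t2 _; rewrite -(mesh_node n m) ler_pM2r ?mesh_gt0//.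
  by rewrite ler_nat.
exact: (semigroup_Lp1 LU (node_gt0 _ _)).
Qed.

Lemma mesh_cell n m t : 0 < t -> t <= n%:R ->
  exists2 k : 'I_(n * 2 ^ m), k%:R * mesh m < t & t <= k.+1%:R * mesh m.
Proof.
move=> t0 tn.
have ex : exists k, t <= k%:R * mesh m by exists (n * 2 ^ m)%N; rewrite mesh_node.
case: (ex_minnP ex) => -[|k] tk mk; first by move: tk; rewrite mul0r leNgt t0.
have kn : (k < n * 2 ^ m)%N by apply: mk; rewrite mesh_node.
exists (Ordinal kn) => //=; rewrite ltNge; apply/negP => /mk.
by rewrite ltnn.
Qed.

Lemma cell_unique m k k' t : k%:R * mesh m < t -> t <= k.+1%:R * mesh m ->
  k'%:R * mesh m < t -> t <= k'.+1%:R * mesh m -> k = k'.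
Proof.
move=> a1 a2 b1 b2; apply/eqP; rewrite eqn_leq -ltnS -[X in _ && X]ltnS.
have := lt_le_trans a1 b2; have := lt_le_trans b1 a2.
by rewrite !ltr_pM2r ?mesh_gt0// !ltr_nat => -> ->.
Qed.

Lemma simple_val_step n m f (k : 'I_(n * 2 ^ m)) t :
  k%:R * mesh m < t -> t <= k.+1%:R * mesh m ->
  simple_val (riemann_step n m f) t = U (k.+1%:R * mesh m) f.
Proof.
move=> a1 a2; rewrite /simple_val /riemann_step big_map.
have -> : iota 0 (n * 2 ^ m) = index_iota 0 (n * 2 ^ m) by rewrite /index_iota subn0.
rewrite big_mkord.
rewrite (bigD1 k)//= big1 ?addr0 => [|k' k'k].
  by rewrite indicE mem_set ?scale1r//= in_itv/= a1 a2.
rewrite indicE memNset ?scale0r//= in_itv/= => /andP[b1 b2].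
by move/eqP: k'k; apply; apply: val_inj; exact: cell_unique b1 b2 a1 a2.
Qed.

Lemma step_close f (e : R) : Lp mu 1%E f -> 0 < e ->
  exists m0, forall n m t, (m0 <= m)%N -> 0 < t -> t <= n%:R ->
    pnorm mu 1%E (U t f - simple_val (riemann_step n m f) t) <= e.
Proof.
move=> pf e0; have [delta d0 H] := semigroup_modulus CU LU pf e0.
have half1 : `|2^-1 : R| < 1 by rewrite ger0_norm// invf_lt1// ltr1n.
have [m0 m0P] : exists m0, forall m, (m0 <= m)%N -> `|mesh m| <= delta / 2.
  by apply: cvg0_eventually; [exact: cvg_expr half1|rewrite divr_gt0].
exists m0 => n m t mm t0 tn; have [k k1 k2] := mesh_cell m t0 tn.
rewrite (simple_val_step _ k1 k2); apply: H => //; first exact: node_gt0.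
rewrite distrC ger0_norm ?subr_ge0//.
have := m0P m mm; rewrite (gtr0_norm (mesh_gt0 m)) => md.
have : k.+1%:R * mesh m = k%:R * mesh m + mesh m by rewrite -natr1 mulrDl mul1r.
lra.
Qed.

Lemma measurable_semigroup_dist f g (M : R) : Lp mu 1%E f -> Lp mu 1%E g ->
  measurable_fun `]0, M] (fun t => pnorm mu 1%E (U t f - g)).
Proof.
(* Measurability comes from continuity, which is stated on an open set; []0, M]] is not open, the
   half-line is. *)
move=> pf pg; apply: (@measurable_funS _ _ _ _ (`]0, +oo[%classic : set R)) => //.
  by move=> t /=; rewrite !in_itv/= => /andP[-> _].
apply: open_continuous_measurable_fun; first exact: interval_open.
move=> t /set_mem /=; rewrite in_itv/= andbT => t0.
apply/cvgrPdist_le => e e0; have [delta d0 H] := semigroup_modulus CU LU pf e0.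
have md : 0 < Num.min delta t by rewrite lt_min d0.
exists (Num.min delta t) => //= t' /=; rewrite lt_min => /andP[tt' t't].
have t'0 : 0 < t' by move: t't; rewrite ltr_distlC subrr => /andP[].
have pU := semigroup_Lp1 LU t0 pf; have pU' := semigroup_Lp1 LU t'0 pf.
apply: le_trans (ler_pnorm_dist _ _ _) _ => //; try exact: LpB.
by rewrite opprB addrA subrK; exact: H.
Qed.

(** The step function is constant on each cell, so the error is a finite sum of indicators times
    distances to fixed functions. *)
Lemma measurable_step_error n m f : Lp mu 1%E f ->
  measurable_fun `]0, n%:R : R]
    (fun t => pnorm mu 1%E (U t f - simple_val (riemann_step n m f) t)).
Proof.
move=> pf.
apply: (@eq_measurable_fun _ _ _ _ _ (fun t => \sum_(k < n * 2 ^ m)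
   \1_(`]k%:R * mesh m, k.+1%:R * mesh m]%classic) t *
   pnorm mu 1%E (U t f - U (k.+1%:R * mesh m) f))).
  move=> t /set_mem /=; rewrite in_itv/= => /andP[t0 tn].
  have [k a1 a2] := mesh_cell m t0 tn.
  rewrite (simple_val_step _ a1 a2) (bigD1 k)//= big1 ?addr0 => [|k' k'k].
    by rewrite indicE mem_set ?mul1r//= in_itv/= a1 a2.
  rewrite indicE memNset ?mul0r//= in_itv/= => /andP[b1 b2].
  by move/eqP: k'k; apply; apply: val_inj; exact: cell_unique b1 b2 a1 a2.
apply: measurable_sum => k; apply: measurable_funM.
  exact: measurable_indic.
apply: measurable_semigroup_dist => //.
exact: (semigroup_Lp1 LU (node_gt0 _ _)).
Qed.

Lemma step_error_small n f (e : R) : Lp mu 1%E f -> 0 < e -> exists m0, forall m,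
  (m0 <= m)%N ->
  (step_error mu (fun t => U t f) n%:R (riemann_step n m f) <= e%:E)%E.
Proof.
(* The uniform error is integrated over an interval of length [n]; dividing by [n.+1] also covers
   [n = 0]. *)
move=> pf e0; have e'0 : 0 < e / n.+1%:R by rewrite divr_gt0.
have [m0 H] := step_close pf e'0; exists m0 => m mm.
apply: (@le_trans _ _ (\int[leb]_(t in `]0%R, n%:R]) (e / n.+1%:R)%:E)%E).
  apply: ge0_le_integral => //.
  - by move=> t _; rewrite lee_fin pnorm_ge0.
  - by apply/measurable_EFinP; exact: measurable_step_error.
  - by move=> t /=; rewrite in_itv/= => /andP[t0 tn]; rewrite lee_fin; exact: H.
rewrite integral_cst//= lebesgue_measure_itv/= lte_fin.
case: ifPn => [_|_]; last by rewrite mule0 lee_fin ltW.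
rewrite oppr0 adde0 -EFinM lee_fin -mulrA ger_pMr// mulrC ler_pdivrMr// mul1r.
by rewrite ler_nat.
Qed.

Lemma step_error_cvg0 n f : Lp mu 1%E f ->
  step_error mu (fun t => U t f) n%:R (riemann_step n m f) @[m --> \oo] --> 0%E.
Proof.
move=> pf; apply/fine_cvgP.
have e0 m : (0 <= step_error mu (fun t => U t f) n%:R (riemann_step n m f))%E.
  by apply: integral_ge0 => t _; rewrite lee_fin pnorm_ge0.
split.
  have [m0 H] := step_error_small n pf (@ltr01 R); exists m0 => // m /H h.
  by rewrite ge0_fin_numE//; apply: le_lt_trans h _; exact: ltry.
apply: cvg0P => e e_gt0; have [m0 H] := step_error_small n pf e_gt0.
exists m0 => // m /H h /=; rewrite ger0_norm ?fine_ge0//.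
rewrite -lee_fin fineK// ge0_fin_numE//; apply: le_lt_trans h _; exact: ltry.
Qed.

Lemma Lp_riemann_sum n m f : Lp mu 1%E f -> Lp mu 1%E (riemann_sum n m f).
Proof.
by move=> pf; rewrite -simple_integral_step;
  have [] := Lp_simple (@simple_on_step n m f pf).
Qed.

(** The distance of two Riemann sums is at most the sum of their step errors, so they are Cauchy in
    L1; the step functions themselves witness that the limit is a Bochner integral. *)
Lemma riemann_sum_bochner n f : Lp mu 1%E f ->
  exists2 h, is_bochner_integral mu (fun t => U t f) n%:R h &
    pnorm mu 1%E (riemann_sum n m f - h) @[m --> \oo] --> (0 : R).
Proof.
move=> pf.
have pR m := Lp_riemann_sum n m pf.
have [|h ph ch] := L1_complete pR.
  move=> e e0.
  have e2 : 0 < e / 2 by rewrite divr_gt0.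
  have [m0 H] := step_error_small n pf e2; exists m0 => i j /H hi /H hj.
  rewrite -!simple_integral_step -lee_fin [e]splitr EFinD.
  apply: le_trans (leeD hi hj); apply: simple_integral_dist.
  - by move=> t t0; exact: semigroup_Lp1.
  - exact: simple_on_step.
  - exact: simple_on_step.
  - exact: measurable_step_error.
  - exact: measurable_step_error.
exists h => //; split => //; exists (fun m => riemann_step n m f); split.
- by move=> m; exact: simple_on_step.
- by move=> m; exact: measurable_step_error.
- exact: step_error_cvg0.
- by under eq_fun do rewrite simple_integral_step.
Qed.

Definition partial_potential n f : fn := bochner_integral mu (fun t => U t f) n%:R.

Lemma partial_potentialP n f : Lp mu 1%E f ->
  Lp mu 1%E (partial_potential n f) /\
  pnorm mu 1%E (riemann_sum n m f - partial_potential n f) @[m --> \oo] --> (0 : R).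
Proof.
move=> pf; have [h bh ch] := riemann_sum_bochner n pf.
(* Existence ensures that [xget] does not fall back on its default value 0. *)
have bp : is_bochner_integral mu (fun t => U t f) n%:R (partial_potential n f).
  exact: (xgetPex 0 (ex_intro _ h bh)).
have [ph _] := bh; have [pp _] := bp; split => //.
have hp : h = partial_potential n f %[ae mu].
  apply: bochner_integral_unique bh bp => t t0.
  exact: semigroup_Lp1.
apply: cvg0_le ch => m; rewrite pnorm_ge0 le_eqVlt; apply/orP; left; apply/eqP.
have mR := Lp_measurable (Lp_riemann_sum n m pf).
apply: ae_pnorm1.
- by apply: measurable_funB => //; exact: Lp_measurable pp.
- by apply: measurable_funB => //; exact: Lp_measurable ph.
- by apply: filterS hp => x /[apply]; rewrite !fctE => ->.
Qed.

End Riemann.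

(** * Properties of the partial potentials *)

Section potential.
Context d (T : measurableType d) (R : realType).
Variable mu : {measure set T -> \bar R}.
Local Notation fn := (T -> R).
Local Notation itg f := (mu.-integrable setT (EFin \o f)).
Local Notation "'J' f" := (Rintegral mu setT f) (at level 10, f at level 9).
Implicit Types (f g u v : fn) (t : R) (n m k : nat).

(** Where [X n] is nonnegative, the negative part of [v] is at most [|X n - v|]; its integral
    therefore vanishes, with no a.e. convergent subsequence to extract. *)
Lemma L1_lim_ge0 (X : nat -> fn) v n0 : (forall n, Lp mu 1%E (X n)) ->
  Lp mu 1%E v -> pnorm mu 1%E (X n - v) @[n --> \oo] --> (0 : R) ->
  (forall n, (n0 <= n)%N -> ae_nonneg mu (X n)) -> ae_nonneg mu v.
Proof.
move=> pX pv cX X0; set w : fn := fun x => Num.max (- v x) 0.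
have mv := Lp_measurable pv.
have w0 x : 0 <= w x by rewrite le_max lexx orbT.
have wE x : `|w x| = w x by rewrite ger0_norm.
have iw : itg w.
  apply: (@le_itg _ _ _ _ _ (fun x => `|v x|)).
  - by apply: measurable_maxr => //; exact: measurableT_comp.
  - by apply/itg_norm/Lp1P.
  - by apply: aeW => x; rewrite wE ge_max normr_ge0 andbT -normrN ler_norm.
have wX n : (n0 <= n)%N -> J w <= pnorm mu 1%E (X n - v).
  move=> /X0 Xn0; rewrite pnorm1E; apply: ler_J => //.
    by apply/itg_norm/Lp1P; exact: LpB.
  apply: filterS Xn0 => x Xnx; rewrite ge_max normr_ge0 andbT !fctE.
  by apply: le_trans (ler_norm _); rewrite addrC lerDl.
have Jw0 : J w <= 0.
  apply: (@le_of_cvg0 _ _ (fun n => pnorm mu 1%E (X (n + n0)%N - v))).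
    by move=> n; apply: wX; exact: leq_addl.
  by rewrite (cvg_shiftn n0 (fun n => pnorm mu 1%E (X n - v))).
have := @J_norm_eq0 _ _ _ mu w iw.
have -> : (fun x => `|w x|) = w by apply/funext.
have -> : J w = 0 by apply/eqP; rewrite eq_le Jw0 /=; apply: Rintegral_ge0 => x _;
  exact: w0.
move=> /(_ erefl); apply: filterS => x /(_ I) wx.
have vw : - v x <= w x by rewrite le_max lexx.
by move: vw; rewrite wx oppr_le0.
Qed.

Lemma L1_lim_le (X Y : nat -> fn) u v n0 : (forall n, Lp mu 1%E (X n)) ->
  (forall n, Lp mu 1%E (Y n)) -> Lp mu 1%E u -> Lp mu 1%E v ->
  pnorm mu 1%E (X n - u) @[n --> \oo] --> (0 : R) ->
  pnorm mu 1%E (Y n - v) @[n --> \oo] --> (0 : R) ->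
  (forall n, (n0 <= n)%N -> {ae mu, forall x, X n x <= Y n x}) ->
  {ae mu, forall x, u x <= v x}.
Proof.
move=> pX pY pu pv cX cY XY.
suff : ae_nonneg mu (v - u) by apply: filterS => x; rewrite !fctE subr_ge0.
apply: (@L1_lim_ge0 (fun n => Y n - X n) _ n0).
- by move=> n; exact: LpB.
- exact: LpB.
- apply: cvg0_le (_ : (pnorm mu 1%E (Y n - v) + pnorm mu 1%E (X n - u)) @[n --> \oo]
    --> 0).
    move=> n; rewrite pnorm_ge0 /=.
    have -> : Y n - X n - (v - u) = (Y n - v) - (X n - u).
      by apply/funext => x; rewrite !fctE; ring.
    by apply: ler_pnorm_sub => //; exact: LpB.
  by rewrite -[X in _ --> X]addr0; exact: cvgD.
- by move=> n /XY; apply: filterS => x; rewrite !fctE subr_ge0.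
Qed.

Variable U : R -> fn -> fn.
Hypothesis CU : C0_contraction_semigroup mu U.
Hypothesis LU : L1_extension mu U.

Lemma sum_shift_le (a : nat -> R) (s K L : nat) : (forall k, 0 <= a k) ->
  (s + K <= L)%N -> \sum_(k < K) a (k + s)%N <= \sum_(k < L) a k.
Proof.
move=> a0 sKL; rewrite -(big_mkord xpredT (fun k => a (k + s)%N)) -(big_mkord xpredT a).
rewrite (@big_cat_nat _ _ _ s 0 L)//=; last by rewrite (leq_trans _ sKL)// leq_addr.
rewrite (@big_cat_nat _ _ _ (s + K) s L)//=; last exact: leq_addr.
have -> : \sum_(s <= i < s + K) a i = \sum_(0 <= i < K) a (i + s)%N.
  by rewrite -{1}[s]add0n big_addn addKn.
rewrite -[leLHS]add0r lerD ?sumr_ge0// -[leLHS]addr0 lerD ?sumr_ge0//.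
Qed.

Lemma riemann_sumE n m f x : riemann_sum U n m f x =
  \sum_(k < n * 2 ^ m) mesh R m * U (k.+1%:R * mesh R m) f x.
Proof. by rewrite /riemann_sum fct_sumE. Qed.

(** With [t] the dyadic shift, the left side samples the orbit of [f] on []t, t + N]], a part of
    []0, N + n]]; the samples left out are nonnegative. The condition [p <= m] makes [t] a node of
    the finer mesh. *)
Lemma riemann_sum_shift n p N m j f : (p <= m)%N -> j.+1%:R * mesh R p <= n%:R ->
  Lp mu 1%E f -> ae_nonneg mu f ->
  {ae mu, forall x, riemann_sum U N m (U (j.+1%:R * mesh R p) f) x <=
                    riemann_sum U (N + n) m f x}.
Proof.
move=> pm jn pf f0.
pose s := (j.+1 * 2 ^ (m - p))%N.
have sE : j.+1%:R * mesh R p = s%:R * mesh R m.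
  have -> : mesh R m = 2^-1 ^+ (m - p) * mesh R p by rewrite /mesh -exprD subnK.
  rewrite /s natrM natrX -mulrA; congr (_ * _); rewrite mulrA -exprMn.
  by rewrite mulfV ?expr1n ?mul1r// pnatr_eq0.
have sn : (s <= n * 2 ^ m)%N.
  by rewrite -(ler_nat R) -(ler_pM2r (mesh_gt0 R m)) -sE mesh_node.
have U0 : {ae mu, forall x k, 0 <= U (k.+1%:R * mesh R m) f x}.
  by apply/ae_foralln => k; apply: L1_positive => //; exact: node_gt0.
have US : {ae mu, forall x k, U (k.+1%:R * mesh R m) (U (j.+1%:R * mesh R p) f) x =
    U ((k + s).+1%:R * mesh R m) f x}.
  apply/ae_foralln => k.
  have := L1_semigroup LU (node_gt0 R k m) (node_gt0 R j p) pf.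
  by rewrite sE -mulrDl -natrD addSn; apply: filterS => x ->.
apply: filterS2 U0 US => x U0 US.
rewrite !riemann_sumE; under eq_bigr do rewrite US.
apply: (@sum_shift_le (fun k => mesh R m * U (k.+1%:R * mesh R m) f x)).
  by move=> k; rewrite mulr_ge0// ltW// mesh_gt0.
by rewrite mulnDl addnC leq_add2l.
Qed.

Lemma riemann_sum_mono N n m f : Lp mu 1%E f -> ae_nonneg mu f ->
  {ae mu, forall x, riemann_sum U N m f x <= riemann_sum U (N + n) m f x}.
Proof.
move=> pf f0.
have U0 : {ae mu, forall x k, 0 <= U (k.+1%:R * mesh R m) f x}.
  by apply/ae_foralln => k; apply: L1_positive => //; exact: node_gt0.
apply: filterS U0 => x U0; rewrite !riemann_sumE.
have := @sum_shift_le (fun k => mesh R m * U (k.+1%:R * mesh R m) f x) 0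
  (N * 2 ^ m) ((N + n) * 2 ^ m).
under eq_bigr do rewrite addn0; apply.
  by move=> k; rewrite mulr_ge0// ltW// mesh_gt0.
by rewrite add0n leq_mul2r leq_addr orbT.
Qed.

Local Notation pp := (partial_potential mu U).

Lemma partial_potential_mono f : Lp mu 1%E f -> ae_nonneg mu f ->
  {ae mu, forall x, {homo (fun n => pp n f x) : n m / (n <= m)%N >-> n <= m}}.
Proof.
move=> pf f0.
suff : {ae mu, forall x n, pp n f x <= pp n.+1 f x}.
  by apply: filterS => x h; apply: homo_leq => //; exact: le_trans.
apply/ae_foralln => n; have [p1 c1] := partial_potentialP CU LU n pf.
have [p2 c2] := partial_potentialP CU LU n.+1 pf.
apply: (L1_lim_le (n0 := 0%N) _ _ p1 p2 c1 c2).
- by move=> m; exact: Lp_riemann_sum.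
- by move=> m; exact: Lp_riemann_sum.
- by move=> m _; rewrite -addn1; exact: riemann_sum_mono.
Qed.

Lemma partial_potential_shift n p N j f : j.+1%:R * mesh R p <= n%:R ->
  Lp mu 1%E f -> ae_nonneg mu f ->
  {ae mu, forall x, pp N (U (j.+1%:R * mesh R p) f) x <= pp (N + n) f x}.
Proof.
move=> jn pf f0; have pU := semigroup_Lp1 LU (node_gt0 R j p) pf.
have [p1 c1] := partial_potentialP CU LU N pU.
have [p2 c2] := partial_potentialP CU LU (N + n) pf.
apply: (L1_lim_le (n0 := p) _ _ p1 p2 c1 c2).
- by move=> m; exact: Lp_riemann_sum.
- by move=> m; exact: Lp_riemann_sum.
- by move=> m pm; exact: riemann_sum_shift.
Qed.

(** Vanishing at dyadic times is enough because the Riemann sums sample no others; on [D] they are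
    all 0, and so is their L1 limit. *)
Lemma partial_potential_eq0 (D : set T) n f : measurable D -> Lp mu 1%E f ->
  ae_nonneg mu f ->
  (forall p j, {ae mu, forall x, D x -> U (j.+1%:R * mesh R p) f x = 0}) ->
  {ae mu, forall x, D x -> pp n f x = 0}.
Proof.
move=> mD pf f0 UD; have [p1 c1] := partial_potentialP CU LU n pf.
pose r (g : fn) : fn := g \* \1_D.
have pr g : Lp mu 1%E g -> Lp mu 1%E (r g).
  move=> /Lp1P ig; apply/Lp1P; apply: le_itg (itg_norm ig) _.
    by apply: measurable_funM; [exact: measurable_itg ig|exact: measurable_indic].
  apply: aeW => x; rewrite /r /= indicE; case: (_ \in _); rewrite ?mulr1//.
  by rewrite mulr0 normr0.
have Rm m : {ae mu, forall x, D x -> riemann_sum U n m f x = 0}.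
  have : {ae mu, forall x k, D x -> U (k.+1%:R * mesh R m) f x = 0} by apply/ae_foralln.
  apply: filterS => x H Dx; rewrite riemann_sumE big1// => k _.
  by rewrite H// mulr0.
suff : pnorm mu 1%E (r (pp n f)) <= 0.
  move=> N0; have := @pnorm1_eq0 _ _ _ mu (r (pp n f)) (pr _ p1).
  have -> : pnorm mu 1%E (r (pp n f)) = 0.
    by apply/eqP; rewrite eq_le N0 pnorm_ge0.
  move=> /(_ erefl); apply: filterS => x /(_ I); rewrite /r /= indicE => + Dx.
  by rewrite mem_set// mulr1.
apply: le_of_cvg0 c1 => m; have pR := Lp_riemann_sum LU n m pf.
have pD : Lp mu 1%E (riemann_sum U n m f - pp n f) by exact: LpB.
rewrite !pnorm1E; apply: ler_J; [exact/itg_norm/Lp1P/pr|exact/itg_norm/Lp1P|].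
apply: filterS (Rm m) => x H; rewrite /r /= !fctE indicE.
have [Dx|Dx] := pselect (D x); first by rewrite mem_set// mulr1 H// sub0r normrN.
by rewrite memNset// mulr0 normr0.
Qed.

Lemma le_potential n f x :
  {homo (fun n => pp n f x) : n m / (n <= m)%N >-> n <= m} ->
  ((pp n f x)%:E <= potential mu U f x)%E.
Proof.
move=> nd; rewrite /potential.
have nd' : {homo (fun n => (pp n f x)%:E) : n m / (n <= m)%N >-> (n <= m)%E}.
  by move=> i j ij; rewrite lee_fin nd.
rewrite (cvg_lim _ (ereal_nondecreasing_cvgn nd'))//.
by apply: ereal_sup_ubound; exists n.
Qed.

(** Bernoulli's inequality bounds the discrete decay factor by [1 / (1 + a * n)] for every mesh; it
    is weaker than an exponential but still tends to 0. *)
Lemma bernoulli_ge (x : R) K : 0 <= x -> 1 + K%:R * x <= (1 + x) ^+ K.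
Proof.
move=> x0; elim: K => [|K IH]; first by rewrite mul0r addr0 expr0.
rewrite exprS -natr1; have Kx : 0 <= K%:R * x by rewrite mulr_ge0.
apply: (@le_trans _ _ ((1 + x) * (1 + K%:R * x))).
  by have := mulr_ge0 x0 Kx; lra.
by rewrite ler_pM2l// ltr_wpDr.
Qed.

Lemma operator_ip_linl (S : fn -> fn) D (a : R) u v w : linear_operator mu 2%:E D S ->
  D u -> D v -> Lp mu 2%:E w ->
  ip mu (S (a *: u + v)) w = a * ip mu (S u) w + ip mu (S v) w.
Proof.
move=> LS Du Dv pw; have lt12 : (1 <= 2%:E :> \bar R)%E by exact: lee1n.
have pSu := operator_Lp LS Du; have pSv := operator_Lp LS Dv.
have Duv := subspaceP (operator_dom LS) a Du Dv.
rewrite -ip_linl//; apply: ae_ip (operatorP LS a Du Dv) (aeW _ _) => //.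
- exact: Lp_measurable (operator_Lp LS Duv).
- exact: Lp_measurable (Lp_lin a lt12 pSu pSv).
- exact: Lp_measurable pw.
- exact: Lp_measurable pw.
Qed.

(* A discrete form of [G_a h <= \int_0^n T_t f dt + exp(-a n) T_n (G_a h)]: by the
   generator equation [u = q (U_d u + d h - d rho)] with [q = 1 / (1 + a d)], and
   iterating this along multiples of the mesh [d] leaves a Riemann sum. *)
Lemma resolvent_le_potential f h u (a : R) (F : set T) n :
  Lp mu 1%E f -> ae_nonneg mu f ->
  Lp mu 1%E h -> Lp mu 2%:E h -> {ae mu, forall x, h x <= f x} ->
  0 < a -> Lp mu 2%:E u -> has_generator_value mu U u (a *: u - h) ->
  measurable F -> (mu F < +oo)%E ->
  ip mu u \1_F <= ip mu (pp n f) \1_F +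
    pnorm mu 2%:E u * pnorm mu 2%:E (\1_F : fn) / (1 + a * n%:R).
Proof.
move=> pf f0 ph1 ph2 hf a0 pu gen mF Ffin.
have lt12 : (1 <= 2%:E :> \bar R)%E by exact: lee1n.
have pF := indic_Lp2 mF Ffin.
pose c := pnorm mu 2%:E (\1_F : fn).
have c0 : 0 <= c by exact: pnorm_ge0.
have b1 := indic_bounded_by1 R mF.
have [pp1 cpp] := partial_potentialP CU LU n pf.
pose de m := mesh R m.
have de0 m : 0 < de m by exact: mesh_gt0.
pose rho m := (de m)^-1 *: (U (de m) u - u) - (a *: u - h).
have pU t : 0 < t -> Lp mu 2%:E (U t u) by move=> t0; exact: (semigroup_Lp2 CU).
have ah2 : Lp mu 2%:E (a *: u - h) by apply: LpB => //; exact: LpZ.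
have prho m : Lp mu 2%:E (rho m).
  apply: LpB => //; apply: LpZ => //; apply: LpB => //; exact: pU.
have rho0 : pnorm mu 2%:E (rho m) @[m --> \oo] --> (0 : R) by exact: cvg_mesh gen.
have [CU1 CU2] := CU.
have Udu : pnorm mu 2%:E (U (de m) u - u) @[m --> \oo] --> (0 : R).
  exact: cvg_mesh (semigroup_continuous CU1 pu).
have Uop t : 0 < t -> linear_operator mu 2%:E (Lp mu 2%:E) (U t).
  by move=> t0; exact: (semigroup_operator CU1 t0).
have ipF_bound w : Lp mu 2%:E w -> `|ip mu w \1_F| <= pnorm mu 2%:E w * c.
  by move=> pw; exact: ip_bound.
(* The iteration starts from [U (de m) u], since times are positive; replacing it by [u] costs an
   error that vanishes by strong continuity. *)
have main m : ip mu (U (de m) u) \1_F <=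
    pairing mu (\1_F : fn) (riemann_sum U n m f) +
    n%:R * (c * pnorm mu 2%:E (rho m)) +
    pnorm mu 2%:E u * c / (1 + a * n%:R).
  pose q := (1 + a * de m)^-1.
  have ad0 : 0 < 1 + a * de m by rewrite ltr_wpDl// mulr_gt0.
  have q0 : 0 < q by rewrite invr_gt0.
  have q1 : q <= 1 by rewrite invf_le1// lerDl mulr_ge0// ltW.
  pose A k := ip mu (U (k.+1%:R * de m) u) \1_F.
  pose b k := pairing mu (\1_F : fn) (U (k.+1%:R * de m) f).
  pose r := c * pnorm mu 2%:E (rho m).
  have r0 : 0 <= r by rewrite mulr_ge0// pnorm_ge0.
  have b0 k : 0 <= b k.
    have Ub := L1_positive LU (node_gt0 R k m) pf f0.
    rewrite /b /pairing -[leLHS](pairing0 mu (\1_F : fn)) /pairing.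
    apply: ler_J.
    - by apply: pairing_itg => //; exact: Lp0.
    - by apply: pairing_itg => //; exact: (semigroup_Lp1 LU (node_gt0 R k m)).
    - by apply: filterS Ub => x Ux /=; rewrite mul0r mulr_ge0.
  have stepA k : A k <= q * (A k.+1 + de m * b k + de m * r).
    have t0 := node_gt0 R k m; set t := k.+1%:R * de m in t0 *.
    have pUh := semigroup_Lp2 CU t0 ph2; have pUr := semigroup_Lp2 CU t0 (prho m).
    have pUd := pU _ (de0 m); have pUUd := semigroup_Lp2 CU t0 pUd.
    have uE : U (de m) u = (1 + a * de m) *: u + (de m *: rho m - de m *: h).
      apply/funext => x; rewrite /rho !fctE /= /GRing.scale /=.
      by field; rewrite gt_eqF.
    pose l w := ip mu (U t w) \1_F.
    have l_lin (z : R) v w : Lp mu 2%:E v -> Lp mu 2%:E w -> l (z *: v + w) = z * l v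
      + l w.
      by move=> pv pw; apply: operator_ip_linl (Uop t t0) _ _ _.
    have l0 : l 0 = 0.
      have := l_lin 1 0 0 (Lp0 mu lt12) (Lp0 mu lt12).
      by rewrite scaler0 addr0 mul1r => /eqP; rewrite -subr_eq subrr eq_sym => /eqP.
    have lZ (z : R) v : Lp mu 2%:E v -> l (z *: v) = z * l v.
      by move=> pv; rewrite -[_ *: _]addr0 l_lin ?l0 ?addr0//; exact: Lp0.
    have AE : A k.+1 = (1 + a * de m) * A k + de m * l (rho m) - de m * l h.
      transitivity (l (U (de m) u)).
        rewrite /A /l; have := semigroupD CU1 t0 (de0 m) pu.
        have -> : t + de m = k.+2%:R * de m by rewrite /t -[in RHS]natr1 mulrDl mul1r.
        move=> E1; apply: ae_ip E1 _; try exact: aeW; try exact: measurable_indic.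
          exact/Lp_measurable/pU/node_gt0.
        exact: Lp_measurable pUUd.
      rewrite uE -scaleNr l_lin//; last by apply: Lp_lin => //; exact: LpZ.
      by rewrite l_lin// ?lZ ?mulNr ?addrA//; exact: LpZ.
    have hb : l h <= b k.
      rewrite /l /b /pairing /ip; apply: ler_J.
      - by apply: ip_itg => //.
      - by apply: pairing_itg => //; exact: (semigroup_Lp1 LU t0).
      - by apply: filterS (semigroup_le LU t0 ph1 pf hf) => x Ux /=; rewrite ler_wpM2r.
    have hr : - r <= l (rho m).
      have := ipF_bound _ pUr; rewrite ler_norml => /andP[+ _].
      apply: le_trans; rewrite lerN2 /r mulrC ler_wpM2l//; exact: CU2.
    rewrite /q ler_pdivlMl// AE.
    have := ler_wpM2l (ltW (de0 m)) hb; have := ler_wpM2l (ltW (de0 m)) hr.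
    by rewrite mulrN; lra.
  (* The powers of [q] in front of the nonnegative terms [b k] and [r] are at most 1 and are
     dropped. *)
  have iter K : A 0%N <= q ^+ K * A K + de m * (\sum_(k < K) b k) + K%:R * (de m * r).
    elim: K => [|K IH].
      by rewrite expr0 mul1r big_ord0 mulr0 mul0r !addr0.
    apply: le_trans IH _; rewrite big_ord_recr /= exprSr mulrDr -natr1 mulrDl mul1r.
    have qK0 : 0 <= q ^+ K by rewrite exprn_ge0// ltW.
    have qK1 : q ^+ K * q <= 1 by rewrite -exprSr exprn_ile1// ltW.
    have := ler_wpM2l qK0 (stepA K).
    have z1 : 0 <= de m * b K by rewrite mulr_ge0// ltW.
    have z2 : 0 <= de m * r by rewrite mulr_ge0// ltW.
    have := ler_wpM2r z1 qK1; have := ler_wpM2r z2 qK1.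
    rewrite !mul1r mulrA !mulrDr; lra.
  have := iter (n * 2 ^ m)%N; rewrite {1}/A mul1r.
  move/le_trans; apply.
  have nE : (n * 2 ^ m)%:R * (de m * r) = n%:R * r by rewrite mulrA mesh_node.
  have sE : de m * \sum_(k < n * 2 ^ m) b k = pairing mu (\1_F : fn) (riemann_sum U n
    m f).
    rewrite /b /riemann_sum.
    have : forall K, Lp mu 1%E (\sum_(k < K) mesh R m *: U (k.+1%:R * mesh R m) f) /\
        de m * (\sum_(k < K) pairing mu (\1_F : fn) (U (k.+1%:R * de m) f)) =
        pairing mu (\1_F : fn) (\sum_(k < K) mesh R m *: U (k.+1%:R * mesh R m) f).
      elim=> [|K [pK IH]].
        by rewrite !big_ord0 mulr0 pairing0; split => //; exact: Lp0.
      have pUK := semigroup_Lp1 LU (node_gt0 R K m) pf.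
      rewrite !big_ord_recr /= addrC mulrDr IH; split; first exact: Lp_lin.
      by rewrite pairing_lin// addrC.
    by move=> /(_ (n * 2 ^ m)%N)[].
  rewrite nE sE -addrA addrC lerD2l.
  apply: le_trans (ler_norm _) _; rewrite normrM ger0_norm; last first.
    by rewrite exprn_ge0// ltW.
  rewrite mulrC; apply: ler_pM => //.
  - by rewrite exprn_ge0// ltW.
  - apply: le_trans (ipF_bound _ _) _; first exact/pU/node_gt0.
    by apply: ler_wpM2r => //; apply: CU2 => //; exact: node_gt0.
  - rewrite /q exprVn lef_pV2 ?posrE ?exprn_gt0//; last first.
      by rewrite ltr_pwDl// mulr_ge0// ltW.
    rewrite -(mesh_node R n m) mulrCA.
    by apply: bernoulli_ge; rewrite mulr_ge0// ltW.
rewrite -subr_le0; apply: (@le_of_cvg0 _ _ (fun m =>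
  pnorm mu 2%:E (U (de m) u - u) * c + pnorm mu 1%E (riemann_sum U n m f - pp n f) +
  n%:R * c * pnorm mu 2%:E (rho m))).
  move=> m; have := main m.
  have pUd := pU _ (de0 m); have pD : Lp mu 2%:E (U (de m) u - u) by exact: LpB.
  have := ipF_bound _ pD; rewrite ipBl// ler_norml => /andP[+ _].
  have pR := Lp_riemann_sum LU n m pf.
  have := pairing_bound b1 (LpB (lexx _) pR pp1).
  rewrite (_ : pairing mu _ _ = pairing mu (\1_F : fn) (riemann_sum U n m f) - ip mu
    (pp n f) \1_F); last first.
    by rewrite addrC -scaleN1r pairing_lin// mulN1r addrC.
  by rewrite ler_norml => /andP[_]; rewrite -/c -mulrA; lra.
rewrite -[X in _ --> X]addr0; apply: cvgD; last first.
  by rewrite -[X in _ --> X](mulr0 (n%:R * c)); apply: cvgM => //; exact: cvg_cst.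
rewrite -[X in _ --> X]addr0; apply: cvgD => //.
by rewrite -[X in _ --> X](mul0r c); apply: cvgM => //; exact: cvg_cst.
Qed.

End potential.

(** * Maximum principle for the resolvent *)

Section level.
Context d (T : measurableType d) (R : realType).
Variable mu : {measure set T -> \bar R}.
Local Notation fn := (T -> R).
Local Notation itg f := (mu.-integrable setT (EFin \o f)).
Local Notation "'J' f" := (Rintegral mu setT f) (at level 10, f at level 9).
Implicit Types (f g u v : fn) (t : R) (n m k : nat).
Variable U : R -> fn -> fn.
Hypothesis CU : C0_contraction_semigroup mu U.
Hypothesis LU : L1_extension mu U.

(** Tested on the part [F] of [B] where [u > M], the comparison bounds the integral of [u] over [F]
    by [M] times the measure of [F], up to a remainder that vanishes as [n] grows. So [u - M],
    positive on [F], has nonpositive integral there. *)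
Lemma resolvent_le_on f h u (a M : R) (B : set T) :
  Lp mu 1%E f -> ae_nonneg mu f ->
  Lp mu 1%E h -> Lp mu 2%:E h -> {ae mu, forall x, h x <= f x} ->
  0 < a -> Lp mu 2%:E u -> has_generator_value mu U u (a *: u - h) ->
  measurable B -> (mu B < +oo)%E ->
  (forall x n, B x -> partial_potential mu U n f x <= M) ->
  {ae mu, forall x, B x -> u x <= M}.
Proof.
move=> pf f0 ph1 ph2 hf a0 pu gen mB Bfin BM.
have mu' := Lp_measurable pu.
pose F := B `&` [set x | M < u x].
have mF : measurable F.
  by apply: measurableI => //; apply: measurable_lt_set.
have Ffin : (mu F < +oo)%E.
  by apply: le_lt_trans Bfin; apply: le_measure; rewrite ?inE//; exact: subIsetl.
have pF := indic_Lp2 mF Ffin.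
have b1 := indic_bounded_by1 R mF.
have iF : itg (\1_F : fn).
  have := ip_itg pF pF; rewrite (_ : _ \* _ = \1_F)//.
  by apply/funext => x; rewrite /= indicE; case: (_ \in _); rewrite ?mulr1 ?mulr0.
have iuF := ip_itg pu pF.
pose w : fn := (u \* \1_F) - M *: (\1_F : fn).
have iw : itg w by apply: itgB => //; exact: itgZ.
have Fu x : F x -> M < u x by case.
have w0 x : 0 <= w x.
  rewrite /w !fctE /GRing.scale /= indicE; have [Fx|Fx] := pselect (F x).
    by rewrite mem_set// !mulr1 subr_ge0 ltW// Fu.
  by rewrite memNset// !mulr0 subr0.
pose c := pnorm mu 2%:E u * pnorm mu 2%:E (\1_F : fn).
have Jw0 : J w <= 0.
  apply: (@le_of_cvg0 _ _ (fun n => c / (1 + a * n%:R))).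
    move=> n; rewrite JB//; last exact: itgZ.
    rewrite lerBlDl; apply: le_trans (resolvent_le_potential CU LU n pf f0 ph1 ph2 hf
      a0 pu gen mF Ffin) _.
    rewrite lerD2r; have [ppn _] := partial_potentialP CU LU n pf.
    apply: ler_J.
    - exact: pairing_itg.
    - exact: itgZ.
    apply: aeW => x; rewrite !fctE /GRing.scale /= indicE.
    have [Fx|Fx] := pselect (F x); last by rewrite memNset// !mulr0.
    by rewrite mem_set// !mulr1; apply: BM; case: Fx.
  apply: cvg0P => e e0.
  have ce : 0 <= `|c| / (a * e) by rewrite divr_ge0// mulr_ge0// ltW.
  exists (Num.truncn (`|c| / (a * e))).+1 => // n /= nn.
  have n1 : `|c| / (a * e) < n%:R.
    by apply: lt_le_trans (truncnS_gt _) _; rewrite ler_nat.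
  have an0 : 0 < 1 + a * n%:R by rewrite ltr_pwDl// mulr_ge0// ltW.
  rewrite normrM normfV (gtr0_norm an0) ler_pdivrMr//.
  move: n1; rewrite ltr_pdivrMr ?mulr_gt0// => n1.
  by rewrite mulrDr mulr1; lra.
have := @J_norm_eq0 _ _ _ mu w iw.
have -> : (fun x => `|w x|) = w by apply/funext => x; rewrite ger0_norm.
have -> : J w = 0 by apply/eqP; rewrite eq_le Jw0 /=; apply: Rintegral_ge0 => x _;
  exact: w0.
move=> /(_ erefl); apply: filterS => x /(_ I) wx Bx.
rewrite leNgt; apply/negP => Mu; have Fx : F x by [].
by move: wx; rewrite /w !fctE /GRing.scale /= indicE mem_set// !mulr1 => /eqP;
  rewrite subr_eq0 gt_eqF.
Qed.

End level.

(** * Sub-Markovian resolvents and truncation at a level *)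

Section resolvent.
Context d (T : measurableType d) (R : realType).
Variable mu : {measure set T -> \bar R}.
Local Notation fn := (T -> R).
Local Notation "'J' f" := (Rintegral mu setT f) (at level 10, f at level 9).
Implicit Types (f g u v : fn) (a b : R) (n m k : nat).
Variable G : R -> fn -> fn.
Hypothesis CG : C0_contraction_resolvent mu G.
Hypothesis SG : forall a, 0 < a -> sub_markovian mu (fun f => a *: G a f).

Let lt12 : (1 <= 2%:E :> \bar R)%E.
Proof. exact: lee1n. Qed.

Lemma resolvent_Lp2 a f : 0 < a -> Lp mu 2%:E f -> Lp mu 2%:E (G a f).
Proof. by move=> a0; have /operator_Lp := resolvent_operator CG a0; apply. Qed.

Lemma resolvent_lin a (z : R) f g : 0 < a -> Lp mu 2%:E f -> Lp mu 2%:E g ->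
  G a (z *: f + g) = z *: G a f + G a g %[ae mu].
Proof. by move=> a0 pf pg; have /operatorP := resolvent_operator CG a0; apply. Qed.

Lemma resolvent_range a f (C : R) : 0 < a -> 0 < C -> Lp mu 2%:E f ->
  {ae mu, forall x, 0 <= f x <= C} -> {ae mu, forall x, 0 <= a * G a f x <= C}.
Proof.
move=> a0 C0 pf fC; have pg := LpZ C^-1 lt12 pf.
have gu : ae_unit mu (C^-1 *: f).
  apply: filterS fC => x /andP[f0 fC]; rewrite !fctE /GRing.scale /=.
  apply/andP; split; first by rewrite mulr_ge0// invr_ge0 ltW.
  by rewrite ler_pdivrMl// mulr1.
have := SG a0 pg gu; have := resolvent_lin C^-1 a0 pf (Lp0 mu lt12).
rewrite addr0; apply: filterS3 (operator0 lt12 (resolvent_operator CG a0)) => x /(_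
  I) G0 /(_ I).
rewrite !fctE /GRing.scale /= => -> /andP[].
rewrite G0 addr0 mulrCA => h1 h2; apply/andP; split.
  by move: h1; rewrite pmulr_rge0// invr_gt0.
by move: h2; rewrite ler_pdivrMl// mulr1.
Qed.

Lemma excess_Lp2 (M : R) u : 0 < M -> Lp mu 2%:E u -> {ae mu, forall x, 0 <= u x} ->
  {ae mu, forall x, Num.max (u x - M) 0 <= u x} /\
  Lp mu 2%:E (fun x => Num.max (u x - M) 0).
Proof.
move=> M0 pu u0; set v : fn := fun x => _.
have mu' := Lp_measurable pu.
have mv : measurable_fun setT v.
  by apply: measurable_maxr => //; exact: measurable_funB.
have v0 x : 0 <= v x by rewrite le_max lexx orbT.
have vu : {ae mu, forall x, v x <= u x}.
  apply: filterS u0 => x u0; rewrite /v ge_max u0 andbT lerBlDr lerDl; exact: ltW.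
have pv : Lp mu 2%:E v.
  have /Lp2P[_ iu2] := pu.
  apply/Lp2P; split => //; apply: le_itg iu2 _; first exact: measurable_funX.
  apply: filterS vu => x vux; rewrite ger0_norm ?sqr_ge0// ler_pXn2r//.
    by rewrite nnegrE.
  by rewrite nnegrE (le_trans _ vux).
by [].
Qed.

(** Split [u] into [z], the minimum of [u] and [M], and the excess [v]. By the sub-Markov property
    [b *: G b z] stays below [M], which is the value of [z] wherever [v > 0]; the [v] part is
    handled by contractivity. *)
Lemma sub_markovian_dissipative (b M C : R) u : 0 < b -> 0 < M -> Lp mu 2%:E u ->
  {ae mu, forall x, 0 <= u x} ->
  ip mu (b *: G b u) (fun x => Num.max (u x - M) 0) <=
  ip mu u (fun x => Num.max (u x - M) 0).
Proof.
move=> b0 M0 pu u0; set v : fn := fun x => _.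
have v0 x : 0 <= v x by rewrite le_max lexx orbT.
have [vu pv] := excess_Lp2 M0 pu u0; have mv := Lp_measurable pv.
pose z : fn := u - v.
have pz : Lp mu 2%:E z by exact: LpB.
have zr : {ae mu, forall x, 0 <= z x <= M}.
  apply: filterS2 u0 vu => x u0 vux; rewrite /z !fctE subr_ge0 vux /=.
  by rewrite lerBlDl -lerBlDr le_max lexx.
have Gz := resolvent_range b0 M0 pz zr.
have pGu := resolvent_Lp2 b0 pu; have pGv := resolvent_Lp2 b0 pv.
have pbGu := LpZ b lt12 pGu; have pbGv := LpZ b lt12 pGv.
have Guzv : G b u = G b v + G b z %[ae mu].
  have := resolvent_lin 1 b0 pv pz.
  by rewrite !scale1r {1}/z addrC subrK.
apply: (@le_trans _ _ (ip mu z v + ip mu (b *: G b v) v)).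
  rewrite /ip -JD; [|exact: ip_itg..]; apply: ler_J; [exact: ip_itg|apply: itgD;
    exact: ip_itg|].
  apply: filterS2 Guzv Gz => x /(_ I) + /andP[_ Gz].
  rewrite !fctE /GRing.scale /= => ->; rewrite mulrDr mulrDl [leLHS]addrC lerD2r.
  have [Mu|uM] := leP (u x) M.
    by rewrite /v max_r ?subr_le0// !mulr0.
  apply: ler_wpM2r => //; apply: le_trans Gz _.
  have vx : v x = u x - M by rewrite /v max_l// subr_ge0 ltW.
  by rewrite /z !fctE vx opprB addrCA subrr addr0.
have -> : u = z + v by rewrite /z subrK.
rewrite -[z + v]addrC -[X in ip mu (X + z) v]scale1r ip_linl// mul1r addrC lerD2r.
rewrite ip_normsq//; apply: le_trans (ler_norm _) _;
  apply: le_trans (ip_bound _ _) _ => //.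
rewrite expr2; apply: ler_wpM2r; first exact: pnorm_ge0.
exact: resolvent_contraction.
Qed.

(** Test with the excess [v] of [u] over [M]. Dissipativity leads to [a (u, v) <= (h, v)], and the
    right side is 0 because [h] vanishes wherever [v > 0]. As [v <= u], this forces [v = 0]. *)
Lemma maximum_principle a (C M : R) h : 0 < a -> 0 < C -> 0 < M -> Lp mu 2%:E h ->
  {ae mu, forall x, 0 <= h x <= C} ->
  {ae mu, forall x, h x = 0 \/ G a h x <= M} ->
  {ae mu, forall x, G a h x <= M}.
Proof.
move=> a0 C0 M0 ph hC hM; set u := G a h.
have pu : Lp mu 2%:E u := resolvent_Lp2 a0 ph.
have u0 : {ae mu, forall x, 0 <= u x}.
  have := resolvent_range a0 C0 ph hC; apply: filterS => x /andP[+ _].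
  by rewrite pmulr_rge0.
set v : fn := fun x => Num.max (u x - M) 0.
have v0 x : 0 <= v x by rewrite le_max lexx orbT.
have [vu pv] := excess_Lp2 M0 pu u0; have mv := Lp_measurable pv.
have hv0 : ip mu h v = 0.
  rewrite -[RHS](pairing0 mu v) /pairing /ip; apply: ae_J.
  - by apply: measurable_funM => //; exact: Lp_measurable ph.
  - by apply: measurable_funM => //; exact: measurable_cst.
  apply: filterS hM => x [->//|uM] _ /=; rewrite mul0r.
  by rewrite /v max_r ?mulr0// subr_le0.
(* The resolvent equation reads [b G_b u + G_b h = u + a G_b u]; paired with [v], dissipativity
   leaves [a (G_b u, v) <= (G_b h, v)]. The factor [b] is put back so that both sides converge as
   [b] grows. *)
have key b : 0 < b -> a * ip mu (b *: G b u) v <= ip mu (b *: G b h) v.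
  move=> b0; have pGu := resolvent_Lp2 b0 pu; have pGh := resolvent_Lp2 b0 ph.
  have := sub_markovian_dissipative C b0 M0 pu u0; rewrite -/v.
  have E : b *: G b u + G b h = u + a *: G b u %[ae mu].
    have := resolvent_equation CG b0 a0 ph; apply: filterS => x /[apply].
    by rewrite !fctE /GRing.scale /= -/u => E; rewrite -[u x](subrK (G b h x)); lra.
  have : ip mu (b *: G b u + G b h) v = ip mu (a *: G b u + u) v.
    rewrite [_ + u]addrC; apply: ae_ip => //.
    - exact: Lp_measurable (Lp_lin b lt12 pGu pGh).
    - by rewrite addrC; exact: Lp_measurable (Lp_lin a lt12 pGu pu).
    - exact: aeW.
  rewrite !ip_linl// => E1.
  rewrite -[b *: G b u]addr0 -[b *: G b h]addr0 !ip_linl//; try exact: Lp0.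
  have -> : ip mu 0 v = 0 by exact: (pairing0 mu v).
  rewrite !addr0 => h1; have h2 : a * ip mu (G b u) v <= ip mu (G b h) v by lra.
  by rewrite mulrCA ler_pM2l.
have ipuv : ip mu u v <= 0.
  rewrite leNgt; apply/negP => uv0.
  (* Passing to the limit on both sides costs at most [(a + 1) * e * (|v| + 1)], with [|v|] the L2
     norm: this is half of [a (u, v)]. *)
  set e := a * ip mu u v / (2 * (a + 1) * (pnorm mu 2%:E v + 1)).
  have v1 : 0 < pnorm mu 2%:E v + 1 by rewrite ltr_wpDl// pnorm_ge0.
  have a1 : 0 < a + 1 by rewrite ltr_wpDl// ltW.
  have e0 : 0 < e by rewrite divr_gt0 ?mulr_gt0.
  have /cvgrPdist_le/(_ e e0)[b1 [_ H1]] := resolvent_continuous CG pu.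
  have /cvgrPdist_le/(_ e e0)[b2 [_ H2]] := resolvent_continuous CG ph.
  pose b := `|b1| + `|b2| + 1.
  have [n1 n2] := (ler_norm b1, ler_norm b2).
  have [n3 n4] := (normr_ge0 b1, normr_ge0 b2).
  have b0 : 0 < b by rewrite /b; lra.
  have bb1 : b1 < b by rewrite /b; lra.
  have bb2 : b2 < b by rewrite /b; lra.
  have := H1 b bb1; have := H2 b bb2; rewrite /= !sub0r !normrN !ger0_norm
    ?pnorm_ge0// => He1 He2.
  have pGu := LpZ b lt12 (resolvent_Lp2 b0 pu);
    have pGh := LpZ b lt12 (resolvent_Lp2 b0 ph).
  have := ip_bound (LpB lt12 pGu pu) pv; have := ip_bound (LpB lt12 pGh ph) pv.
  rewrite !ipBl// hv0 subr0 !ler_norml => /andP[_ h1] /andP[h2 _].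
  have := key b b0.
  have n0 : 0 <= pnorm mu 2%:E v by exact: pnorm_ge0.
  have h3 : pnorm mu 2%:E (b *: G b h - h) * pnorm mu 2%:E v <= e * (pnorm mu 2%:E v
    + 1).
    by apply: ler_pM => //; rewrite ?pnorm_ge0// lerDl.
  have h4 : pnorm mu 2%:E (b *: G b u - u) * pnorm mu 2%:E v <= e * (pnorm mu 2%:E v
    + 1).
    by apply: ler_pM => //; rewrite ?pnorm_ge0// lerDl.
  have eE : e * (pnorm mu 2%:E v + 1) * (a + 1) = a * ip mu u v / 2.
    by rewrite /e; field; rewrite !gt_eqF.
  have auv : 0 < a * ip mu u v by rewrite mulr_gt0.
  have : a * (ip mu u v - e * (pnorm mu 2%:E v + 1)) <= a * ip mu (b *: G b u) v.
    by rewrite ler_pM2l//; lra.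
  by rewrite mulrBr => h5 h6; lra.
have ipvv : ip mu v v <= 0.
  apply: le_trans ipuv; apply: ler_J; [exact: ip_itg..|].
  by apply: filterS vu => x vux; exact: ler_wpM2r.
have : J (fun x => `|(v \* v) x|) = 0.
  have -> : (fun x => `|(v \* v) x|) = v \* v.
    by apply/funext => x; rewrite ger0_norm//= mulr_ge0.
  apply/eqP; rewrite eq_le ipvv /=; apply: Rintegral_ge0 => x _ /=; exact: mulr_ge0.
move/(J_norm_eq0 (ip_itg pv pv)); apply: filterS => x /(_ I) /= /eqP.
rewrite mulf_eq0 orbb => /eqP vx; rewrite -subr_le0 -vx.
by rewrite /v le_max lexx.
Qed.

(** The resolvent equation writes the difference as [(b - a) G_a G_b h]. Positivity is at hand for
    bounded functions, hence the bound [C / b] on the inner resolvent. *)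
Lemma resolvent_antitone a b h (C : R) : 0 < a -> a <= b -> 0 < C -> Lp mu 2%:E h ->
  {ae mu, forall x, 0 <= h x <= C} -> {ae mu, forall x, G b h x <= G a h x}.
Proof.
move=> a0 ab C0 ph hC; have b0 : 0 < b := lt_le_trans a0 ab.
have pGb := resolvent_Lp2 b0 ph.
have Gb : {ae mu, forall x, 0 <= G b h x <= C / b}.
  apply: filterS (resolvent_range b0 C0 ph hC) => x /andP[h1 h2].
  by rewrite -(pmulr_rge0 _ b0) h1 ler_pdivlMr// mulrC.
have Cb0 : 0 < C / b by rewrite divr_gt0.
have GG := resolvent_range a0 Cb0 pGb Gb.
apply: filterS2 GG (resolvent_equation CG a0 b0 ph) => x /andP[+ _] /(_ I).
rewrite !fctE /GRing.scale /= pmulr_rge0// => GG E.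
by rewrite -subr_ge0 E mulr_ge0// subr_ge0.
Qed.

End resolvent.

(** * The form argument *)

Section form_argument.
Context d (T : measurableType d) (R : realType).
Variable mu : {measure set T -> \bar R}.
Local Notation fn := (T -> R).
Local Notation itg f := (mu.-integrable setT (EFin \o f)).
Local Notation "'J' f" := (Rintegral mu setT f) (at level 10, f at level 9).
Implicit Types (f g u v : fn) (a b : R) (n m k : nat).

Let lt12 : (1 <= 2%:E :> \bar R)%E.
Proof. exact: lee1n. Qed.

(** The limit [v] is merely bounded and may fail to be square integrable, so the weight has to lie
    in L1; this is what the condition on [N chi] in [N_domain] is used for. *)
Lemma dominated_J (w : nat -> fn) v g (M : R) :
  (forall n, measurable_fun setT (w n)) -> measurable_fun setT v -> Lp mu 1%E g ->
  {ae mu, forall x, w n x @[n --> \oo] --> v x} ->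
  (forall n, {ae mu, forall x, `|w n x| <= M}) ->
  J (w n \* g) @[n --> \oo] --> J (v \* g).
Proof.
move=> mw mv /Lp1P ig cw wM; have mg := measurable_itg ig.
have ae_wM : {ae mu, forall x n, `|w n x| <= M} by apply/ae_foralln.
have ae_vM : {ae mu, forall x, `|v x| <= M}.
  apply: filterS2 cw ae_wM => x cwx wMx.
  have cn : `|w n x| @[n --> \oo] --> `|v x| by exact: cvg_norm.
  rewrite -(cvg_lim _ cn)//.
  by apply: limr_le; [exact: cvgP cn|exact: nearW].
have iwg n : itg (w n \* g).
  apply: (le_itg _ (itgZ M (itg_norm ig))); first exact: measurable_funM.
  by apply: filterS (wM n) => x wx; rewrite !fctE /= normrM ler_wpM2r.
have ivg : itg (v \* g).
  apply: (le_itg _ (itgZ M (itg_norm ig))); first exact: measurable_funM.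
  by apply: filterS ae_vM => x wx; rewrite !fctE /= normrM ler_wpM2r.
have [|||||_ _ cv] := @dominated_convergence _ _ _ mu _ measurableT
    (fun n => EFin \o (w n \* g)) (EFin \o (v \* g)) (EFin \o (M *: (fun x => `|g x|))).
- by move=> n; exact: measurable_int (iwg n).
- exact: measurable_int ivg.
- apply: filterS cw => x cwx _; apply: cvg_EFin; first exact: nearW.
  by apply: cvgM => //; exact: cvg_cst.
- exact/itgZ/itg_norm.
- apply: filterS ae_wM => x wMx n _.
  by rewrite /= lee_fin normrM ler_wpM2r.
apply: (@fine_cvg _ _ _ _ (fun n => (J (w n \* g))%:E)).
rewrite EFin_J//; have E n : (J (w n \* g))%:E = (\int[mu]_x (EFin \o (w n \* g)%R)
  x)%E.
  by rewrite EFin_J.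
by under eq_fun do rewrite E; exact: cv.
Qed.

Lemma operator_comb p D S a b u v : (1 <= p)%E -> linear_operator mu p D S ->
  D u -> D v -> D (a *: u + b *: v) /\
  S (a *: u + b *: v) = a *: S u + b *: S v %[ae mu].
Proof.
move=> p1 LS Du Dv; have DS := operator_dom LS; have D0 := subspace0 DS.
have Dbv : D (b *: v) by rewrite -[_ *: _]addr0; exact: (subspaceP DS).
split; first exact: (subspaceP DS).
have := operatorP LS b Dv D0; rewrite addr0.
apply: filterS3 (operator0 p1 LS) (operatorP LS a Du Dbv) => x + + + _.
by move=> /(_ I) + /(_ I) -> /(_ I); rewrite !fctE => -> ->; rewrite addr0.
Qed.

Section forms.
Variables (V : set fn) (A : fn -> fn -> R).
Hypothesis DA : dirichlet_form mu V A.

Lemma form_comb_dom a b u v : V u -> V v -> V (a *: u + b *: v).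
Proof.
move=> Vu Vv; have DV := form_dom DA; have V0 := subspace0 DV.
by apply: (subspaceP DV) => //; rewrite -[_ *: _]addr0; exact: (subspaceP DV).
Qed.

Lemma form_combl a b u v w : V u -> V v -> V w ->
  A (a *: u + b *: v) w = a * A u w + b * A v w.
Proof.
move=> Vu Vv Vw; have V0 := subspace0 (form_dom DA).
have A0 : A 0 w = 0.
  have := form_linl DA 1 V0 V0 Vw.
  by rewrite scaler0 addr0 mul1r => /eqP; rewrite -subr_eq subrr eq_sym => /eqP.
have Vbv : V (b *: v) by rewrite -[_ *: _]addr0; apply: (subspaceP (form_dom DA)).
by rewrite (form_linl DA)// -[b *: v]addr0 (form_linl DA)// A0 addr0.
Qed.

Lemma form_combr a b u v w : V u -> V v -> V w ->
  A w (a *: u + b *: v) = a * A w u + b * A w v.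
Proof.
move=> Vu Vv Vw; have V0 := subspace0 (form_dom DA).
have A0 : A w 0 = 0.
  have := form_linr DA 1 Vw V0 V0.
  by rewrite scaler0 addr0 mul1r => /eqP; rewrite -subr_eq subrr eq_sym => /eqP.
have Vbv : V (b *: v) by rewrite -[_ *: _]addr0; apply: (subspaceP (form_dom DA)).
by rewrite (form_linr DA)// -[b *: v]addr0 (form_linr DA)// A0 addr0.
Qed.

(** Valid for a non-symmetric form: the cross terms occur only through [A u v + A v u]. *)
Lemma form_parallelogram u v : V u -> V v ->
  A (u - v) (u - v) =
  2 * A u u + 2 * A v v - 4 * A (2^-1 *: u + 2^-1 *: v) (2^-1 *: u + 2^-1 *: v).
Proof.
move=> Vu Vv; have -> : u - v = 1 *: u + (-1) *: v by rewrite scale1r scaleN1r.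
have V1 := form_comb_dom 1 (-1) Vu Vv; have V2 := form_comb_dom 2^-1 2^-1 Vu Vv.
by rewrite !form_combl// !form_combr//; field.
Qed.

End forms.

Variable G : R -> fn -> fn.
Hypothesis CG : C0_contraction_resolvent mu G.
Hypothesis SG : forall a, 0 < a -> sub_markovian mu (fun f => a *: G a f).
Variables (DL : set fn) (L : fn -> fn).
Hypothesis RG : resolvent_generator mu G DL L.
Variables (DE0 : set fn) (E0 : fn -> fn -> R) (DN : set fn) (N : fn -> fn).
Hypothesis DEC : decomposition mu DL L DE0 E0 DN N.

Lemma resolvent_dom a f : 0 < a -> Lp mu 2%:E f -> DL (G a f).
Proof.
move=> a0 pf; have [_ /(_ a a0)[+ _]] := RG => ->; split.
  exact: (resolvent_Lp2 CG).
by exists f => //; exact: aeW.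
Qed.

(** With [u] the resolvent, [(-L u, u) = (f, u) - a |u|^2] dominates [E0 u u >= 0], and
    [(f, u) <= M J f]. The first bound makes [a u], which is [L u + f], of order [sqrt a] in L2. *)
Lemma resolvent_energy a f (M : R) : 0 < a -> Lp mu 1%E f -> Lp mu 2%:E f ->
  ae_nonneg mu f ->
  {ae mu, forall x, 0 <= G a f x <= M} ->
  a * pnorm mu 2%:E (G a f) ^+ 2 <= M * J f /\ E0 (G a f) (G a f) <= M * J f.
Proof.
move=> a0 pf1 pf f0 GM; set u := G a f.
have pu : Lp mu 2%:E u by exact: (resolvent_Lp2 CG).
have DLu : DL u by exact: resolvent_dom.
have bu : ae_bounded mu u.
  by exists M; apply: filterS GM => x /andP[u0 uM]; rewrite ger0_norm.
have [[DE _] LN domE decE boundE] := DEC.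
have [LL /(_ a a0)[_ /(_ f pf) LE]] := RG.
have Eu := boundE u DLu bu; have E0u := form_ge0 DE (domE u DLu bu).
have E1 : ip mu (- L u) u = ip mu f u - a * pnorm mu 2%:E u ^+ 2.
  rewrite -ip_normsq// addrC -mulNr -ip_linl//.
  have pLu := operator_Lp LL DLu.
  apply: ae_ip.
  - by rewrite -scaleN1r; exact: Lp_measurable (LpZ (-1) lt12 pLu).
  - exact: Lp_measurable (Lp_lin (- a) lt12 pu pf).
  - exact: Lp_measurable pu.
  - exact: Lp_measurable pu.
  - apply: filterS LE => x /[apply]; rewrite !fctE /GRing.scale /= -/u => ->.
    by rewrite opprB addrC mulNr.
  - exact: aeW.
have fu : ip mu f u <= M * J f.
  rewrite -JZ; last exact/Lp1P.
  apply: ler_J; [exact: ip_itg|exact/itgZ/Lp1P|].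
  by apply: filterS2 f0 GM => x f0 /andP[_ uM]; rewrite !fctE /= mulrC ler_wpM2r.
have := sqr_ge0 (pnorm mu 2%:E u); have := ltW a0 => a0' s0.
have as0 := mulr_ge0 a0' s0; rewrite E1 in Eu; split; lra.
Qed.

Lemma bounded_potential_eq0 (chi : nat -> fn) (h : fn) (C M : R) :
  vanishing_cutoff mu DE0 E0 DN N chi ->
  0 < C -> 0 < M -> Lp mu 1%E h -> Lp mu 2%:E h ->
  {ae mu, forall x, 0 <= h x <= C} ->
  (forall a, 0 < a -> {ae mu, forall x, G a h x <= M}) ->
  h = 0 %[ae mu].
Proof.
move=> [chiD chi1 chicvg chivan] C0 M0 ph1 ph hC GM.
have h0 : ae_nonneg mu h by apply: filterS hC => x /andP[].
have [[DE _] LN domE decE boundE] := DEC.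
have [LL _] := RG.
pose al n : R := n.+1%:R^-1.
have al0 n : 0 < al n by rewrite invr_gt0.
have al_anti n m : (n <= m)%N -> al m <= al n.
  by move=> nm; rewrite lef_pV2 ?posrE// ler_nat ltnS.
have alcvg : al n @[n --> \oo] --> (0 : R) by exact: cvg_harmonic.
pose u n := G (al n) h.
have pu n : Lp mu 2%:E (u n) by exact: (resolvent_Lp2 CG).
have u_rng n : {ae mu, forall x, 0 <= u n x <= M}.
  have := resolvent_range CG SG (al0 n) C0 ph hC.
  apply: filterS2 (GM _ (al0 n)) => x uM /andP[+ _].
  by rewrite pmulr_rge0// => ->.
have u_mono n : {ae mu, forall x, u n x <= u n.+1 x}.
  by apply: (resolvent_antitone CG SG (al0 _) _ C0 ph hC); exact: al_anti.
have u_good : {ae mu, forall x, (forall n, 0 <= u n x <= M) /\ (forall n, u n x <= u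
  n.+1 x)}.
  have a1 : {ae mu, forall x n, 0 <= u n x <= M} by apply/ae_foralln.
  have a2 : {ae mu, forall x n, u n x <= u n.+1 x} by apply/ae_foralln.
  by apply: filterS2 a1 a2.
(* The upper limit is defined and measurable everywhere; a.e. it is the monotone limit of the
   [u n]. *)
pose v x := fine (limn_esup (fun n => (u n x)%:E)).
have mv : measurable_fun setT v.
  apply: measurableT_comp => //; apply: measurable_fun_limn_esup => n.
  exact/measurable_EFinP/Lp_measurable/pu.
have v_good : {ae mu, forall x, u n x @[n --> \oo] --> v x /\ (forall n, u n x <= v x)
    /\ 0 <= v x <= M}.
  apply: filterS u_good => x [urng umono].
  have nd : {homo (fun n => u n x) : n m / (n <= m)%N >-> n <= m}.
    by apply: homo_leq => //; exact: le_trans.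
  have cu : cvgn (fun n => u n x).
    apply: nondecreasing_is_cvgn => //; exists M => _ [n _ <-].
    by have /andP[] := urng n.
  have vE : v x = limn (fun n => u n x).
    have cE : (u n x)%:E @[n --> \oo] --> (limn (fun n => u n x))%:E.
      by apply: cvg_EFin; [exact: nearW|exact: cu].
    rewrite /v is_cvg_limn_esupE; last exact: cvgP cE.
    by rewrite (cvg_lim _ cE).
  have uv n : u n x <= v x by rewrite vE; exact: nondecreasing_cvgn_le.
  split; first by rewrite vE.
  split => //; apply/andP; split.
    by apply: le_trans (uv 0%N); have /andP[] := urng 0%N.
  by rewrite vE; apply: limr_le => //; apply: nearW => n; have /andP[] := urng n.
set K := M * J h.
(* Bound on the norm of [L (u n) + h], which is [al n] times the norm of [u n], by the energy
   estimate. *)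
pose beta n := Num.sqrt (al n * K).
have K0 : 0 <= K.
  have [+ _] := resolvent_energy (al0 0%N) ph1 ph h0 (u_rng 0%N).
  by apply: le_trans; rewrite mulr_ge0// ?sqr_ge0// ltW.
have beta_anti n m : (n <= m)%N -> beta m <= beta n.
  by move=> nm; apply: ler_wsqrtr; rewrite ler_wpM2r// al_anti.
(* [Cn n] plays the role of the convex hull of the tail [u n, u n.+1, ...]:
   near-minimizers of [E0] in these nested midpoint-convex sets are E0-Cauchy by
   the parallelogram identity. *)
pose Cn n : set fn := [set w | [/\ DL w, {ae mu, forall x, u n x <= w x <= v x} &
   pnorm mu 2%:E (L w + h) <= beta n]].
have CnS n m : (n <= m)%N -> Cn m `<=` Cn n.
  move=> nm w [DLw uwv Lw]; split => //; last exact: le_trans (beta_anti _ _ nm).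
  apply: filterS2 u_good uwv => x [_ umono] /andP[umw ->]; rewrite andbT.
  have nd : {homo (fun n => u n x) : n m / (n <= m)%N >-> n <= m}.
    by apply: homo_leq => //; exact: le_trans.
  exact: le_trans (nd _ _ nm) umw.
have Cn_bounded n w : Cn n w -> ae_bounded mu w.
  case=> _ uwv _; exists M.
  apply: filterS3 u_good uwv v_good => x [urng _] /andP[uw wv] [_ [_ /andP[_ vM]]].
  rewrite ger0_norm ?(le_trans wv)//.
  by apply: le_trans uw; have /andP[] := urng n.
have Cn_DE n w : Cn n w -> DE0 w.
  by move=> Cw; apply: domE; [case: Cw|exact: Cn_bounded Cw].
have Cnu n : Cn n (u n).
  have DLu : DL (u n) by exact: resolvent_dom.
  split => //; first by apply: filterS v_good => x [_ [-> _]]; rewrite lexx.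
  have [_ /(_ _ (al0 n))[_ /(_ h ph) LE]] := RG.
  have -> : pnorm mu 2%:E (L (u n) + h) = pnorm mu 2%:E (al n *: u n).
    apply: ae_pnorm2.
    - exact: Lp_measurable (LpD lt12 (operator_Lp LL DLu) ph).
    - exact: Lp_measurable (LpZ (al n) lt12 (pu n)).
    - by apply: filterS LE => x /[apply]; rewrite !fctE => ->; rewrite subrK.
  have [+ _] := resolvent_energy (al0 n) ph1 ph h0 (u_rng n); rewrite -/K -/(u n) => en.
  have au0 : 0 <= al n * pnorm mu 2%:E (u n) by rewrite mulr_ge0 ?pnorm_ge0// ltW.
  rewrite pnormZ// gtr0_norm// /beta -[leLHS]ger0_norm// -sqrtr_sqr.
  apply: ler_wsqrtr; rewrite exprMn expr2 -mulrA ler_pM2l//.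
have Cn_mid n w w' : Cn n w -> Cn n w' -> Cn n (2^-1 *: w + 2^-1 *: w').
  move=> [DLw uw Lw] [DLw' uw' Lw'].
  have [DLm Lm] := operator_comb 2^-1 2^-1 lt12 LL DLw DLw'.
  split => //.
    apply: filterS2 uw uw' => x /andP[a1 a2] /andP[b1 b2].
    by rewrite !fctE /GRing.scale /=; apply/andP; split; lra.
  have pL := LpD lt12 (operator_Lp LL DLw) ph;
    have pL' := LpD lt12 (operator_Lp LL DLw') ph.
  have -> : pnorm mu 2%:E (L (2^-1 *: w + 2^-1 *: w') + h) =
      pnorm mu 2%:E (2^-1 *: (L w + h) + 2^-1 *: (L w' + h)).
    apply: ae_pnorm2.
    - exact: Lp_measurable (LpD lt12 (operator_Lp LL DLm) ph).
    - exact: Lp_measurable (LpD lt12 (LpZ 2^-1 lt12 pL) (LpZ 2^-1 lt12 pL')).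
    - by apply: filterS Lm => x /[apply]; rewrite !fctE => ->;
        rewrite /GRing.scale /=; field.
  apply: le_trans (ler_pnormD lt12 (LpZ 2^-1 lt12 pL) (LpZ 2^-1 lt12 pL')) _.
  rewrite !pnormZ// !ger0_norm//; lra.
pose Q w := E0 w w.
pose i n := inf (Q @` Cn n).
have hasinf n : has_inf (Q @` Cn n).
  split; first by exists (Q (u n)); exists (u n).
  by exists 0 => _ [w Cw <-]; apply: (form_ge0 DE); exact: Cn_DE Cw.
have i_le n w : Cn n w -> i n <= Q w.
  by move=> Cw; apply: ge_inf; [case: (hasinf n)|exists w].
have wex n : exists w, Cn n w /\ Q w <= i n + al n.
  have [_ [w Cw <-] /ltW Qw] := inf_adherent (al0 n) (hasinf n).
  by exists w.
have [w_ wP] := choice wex.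
have i_mono : {homo i : n m / (n <= m)%N >-> n <= m}.
  move=> n m nm; apply: lb_le_inf; first by case: (hasinf m).
  by move=> _ [w Cw <-]; apply: i_le; exact: CnS Cw.
have i_bound n : i n <= K.
  apply: le_trans (i_le _ _ (Cnu n)) _.
  by have [_] := resolvent_energy (al0 n) ph1 ph h0 (u_rng n).
have ci : cvgn i.
  by apply: nondecreasing_is_cvgn => //; exists K => _ [n _ <-].
(* For [n <= m] the midpoint of [w_ n] and [w_ m] lies in [Cn n], so the parallelogram identity
   bounds the energy of the difference by [2 (i n + al n) + 2 (i m + al m) - 4 i n]. *)
pose z n := 2 * (limn i - i n) + 4 * al n.
have z0 : z n @[n --> \oo] --> (0 : R).
  rewrite -[X in _ --> X]addr0; apply: cvgD.
    rewrite -[X in _ --> X](mulr0 2); apply: cvgM; first exact: cvg_cst.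
    by rewrite -[X in _ --> X](subrr (limn i)); apply: cvgB => //; exact: cvg_cst.
  by rewrite -[X in _ --> X](mulr0 4); apply: cvgM => //; exact: cvg_cst.
have Qdiff n m : (n <= m)%N -> Q (w_ n - w_ m) <= z n.
  move=> nm; have [Cwn Qwn] := wP n; have [Cwm Qwm] := wP m.
  have Cwm' := CnS _ _ nm _ Cwm.
  rewrite /Q (form_parallelogram DE); [|exact: Cn_DE Cwn|exact: Cn_DE Cwm].
  have := i_le _ _ (Cn_mid _ _ _ Cwn Cwm').
  have im : i m <= limn i by exact: nondecreasing_cvgn_le.
  have alm := al_anti _ _ nm.
  rewrite /z /Q in Qwn Qwm *; lra.
have DEw n : DE0 (w_ n) by have [Cw _] := wP n; exact: Cn_DE Cw.
have app : approximating mu DE0 E0 w_ v.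
  split => //.
    move=> e e0; have e2 : 0 < e ^+ 2 / 2 by rewrite divr_gt0// exprn_gt0.
    have [n0 H] := cvg0_eventually z0 e2.
    have Qs n m : (n0 <= n)%N -> (n <= m)%N -> form_seminorm E0 (w_ n - w_ m) < e.
      move=> nn nm; have := le_trans (Qdiff _ _ nm) (le_trans (ler_norm _) (H _ nn)).
      rewrite /form_seminorm -/(Q _) => Qe.
      apply: (@le_lt_trans _ _ (Num.sqrt (e ^+ 2 / 2))); first exact: ler_wsqrtr.
      rewrite -[ltRHS]gtr0_norm// -sqrtr_sqr ltr_sqrt ?exprn_gt0//.
      by rewrite gtr_pMr ?exprn_gt0// invf_lt1// ltr1n.
    exists ([set k | (n0 <= k)%N], [set k | (n0 <= k)%N]).
      by split; exists n0.
    move=> [m n] /= [mn nn]; have [nm|mn'] := leqP m n; first exact: Qs.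
    (* Exchanging the two indices is read off the right side of the parallelogram identity, which is
       symmetric in them. *)
    have := Qs n m nn (ltnW mn'); rewrite /form_seminorm (form_parallelogram DE)//.
    rewrite [in X in _ -> X](form_parallelogram DE)//.
    by rewrite [2^-1 *: w_ n + _]addrC [2 * E0 (w_ n) _ + _]addrC.
  have uwv : {ae mu, forall x n, u n x <= w_ n x <= v x}.
    by apply/ae_foralln => n; have [[]] := wP n.
  apply: filterS2 v_good uwv => x [cu _] uwv.
  apply: squeeze_cvgr cu (cvg_cst _); exact: nearW.
have ext_v : extended_space mu DE0 E0 v by split => //; exists w_.
have v0 : ae_nonneg mu v by apply: filterS v_good => x [_ [_ /andP[]]].
have vb : ae_bounded mu v.
  by exists M; apply: filterS v_good => x [_ [_ /andP[v0x vM]]]; rewrite ger0_norm.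
have ext_chi n : extended_form E0 w_ (chi n) + ip mu v (N (chi n)) = ip mu h (chi n).
  have [DNc DEc pNc] := chiD n.
  have pc : Lp mu 2%:E (chi n) by apply: (subspace_Lp (form_dom DE)).
  suff cE : E0 (w_ k) (chi n) @[k --> \oo] --> ip mu h (chi n) - ip mu v (N (chi n)).
    by rewrite /extended_form (cvg_lim _ cE)// subrK.
  (* The decomposition applies to [w_ k], a bounded element of [DL]; with [-L w = h - (L w + h)]
     only the residual [L w + h] has to vanish in L2. *)
  have E0E k : E0 (w_ k) (chi n) = (ip mu h (chi n) - ip mu (L (w_ k) + h) (chi n)) -
    ip mu (w_ k) (N (chi n)).
    have [Cw _] := wP k; have [DLw _ _] := Cw.
    have pLw := operator_Lp LL DLw.
    have := decE _ _ DLw (Cn_bounded _ _ Cw) DNc DEc.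
    have -> : - L (w_ k) = h - (L (w_ k) + h) by rewrite opprD addrC addrNK.
    rewrite ipBl//; last exact: LpD.
    by move=> ->; rewrite addrK.
  under eq_fun do rewrite E0E.
  apply: cvgB.
    rewrite -[X in _ --> X]subr0; apply: cvgB; first exact: cvg_cst.
    apply: cvg0P => e e0; have c1 : 0 < pnorm mu 2%:E (chi n) + 1 by rewrite
      ltr_wpDl// pnorm_ge0.
    have e1 : 0 < (e / (pnorm mu 2%:E (chi n) + 1)) ^+ 2 by rewrite exprn_gt0//
      divr_gt0.
    have cK : (al k * K) @[k --> \oo] --> (0 : R).
      by rewrite -[X in _ --> X](mul0r K); apply: cvgM => //; exact: cvg_cst.
    have [n0 H] := cvg0_eventually cK e1; exists n0 => // k /= /H Hk.
    have [Cw _] := wP k; have [DLw _ Lw] := Cw; have pLw := operator_Lp LL DLw.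
    apply: le_trans (ip_bound (LpD lt12 pLw ph) pc) _.
    apply: (@le_trans _ _ (e / (pnorm mu 2%:E (chi n) + 1) * (pnorm mu 2%:E (chi n) +
      1))).
      apply: ler_pM; rewrite ?pnorm_ge0// ?lerDl//.
      apply: le_trans Lw _; rewrite /beta.
      rewrite -[leRHS]gtr0_norm ?divr_gt0// -sqrtr_sqr; apply: ler_wsqrtr.
      exact: le_trans (ler_norm _) Hk.
    by rewrite divfK// gt_eqF.
  apply: (@dominated_J w_ v (N (chi n)) M) => //.
  - by move=> k; apply: Lp_measurable; apply: (subspace_Lp (form_dom DE)).
  - by case: app.
  - move=> k; have [Cw _] := wP k; have [_ uwv _] := Cw.
    apply: filterS3 u_good uwv v_good => x [urng _] /andP[uw wv] [_ [_ /andP[_ vM]]].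
    rewrite ger0_norm ?(le_trans wv)//.
    by apply: le_trans uw; have /andP[] := urng k.
have lim0 := chivan v ext_v v0 vb w_ app.
have lim1 : ip mu h (chi n) @[n --> \oo] --> J (cst 1 \* h).
  have E n : ip mu h (chi n) = J (chi n \* h) by rewrite ipC.
  under eq_fun do rewrite E.
  apply: (@dominated_J chi (cst 1) h 1) => //.
  - move=> n; apply: Lp_measurable; apply: (subspace_Lp (form_dom DE)).
    by have [] := chiD n.
  - by move=> n; apply: filterS (chi1 n) => x /andP[c0 c1]; rewrite ger0_norm.
have Jh0 : J (cst 1 \* h) = 0.
  apply: (cvg_unique _ lim1) => //.
  by move: lim0; under eq_fun do rewrite ext_chi.
apply: J_norm_eq0; first exact/Lp1P.
rewrite -[RHS]Jh0; apply: ae_J.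
- by apply: measurableT_comp => //; exact: Lp_measurable ph.
- by apply: measurable_funM => //; exact: Lp_measurable ph.
- by apply: filterS h0 => x h0 _ /=; rewrite mul1r ger0_norm.
Qed.

End form_argument.

(** * Conservativity *)

Section conservativity.
Context d (T : measurableType d) (R : realType).
Variable mu : {measure set T -> \bar R}.
Local Notation fn := (T -> R).
Implicit Types (f g u v : fn) (a b : R) (n m k : nat).

Let lt12 : (1 <= 2%:E :> \bar R)%E.
Proof. exact: lee1n. Qed.

Variables (U G : R -> fn -> fn) (DL : set fn) (L : fn -> fn).
Hypothesis CU : C0_contraction_semigroup mu U.
Hypothesis LU : L1_extension mu U.
Hypothesis CG : C0_contraction_resolvent mu G.
Hypothesis SG : forall a, 0 < a -> sub_markovian mu (fun f => a *: G a f).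
Hypothesis RG : resolvent_generator mu G DL L.
Hypothesis GU : semigroup_generator mu U DL L.
Variables (DE0 : set fn) (E0 : fn -> fn -> R) (DN : set fn) (N : fn -> fn).
Hypothesis DEC : decomposition mu DL L DE0 E0 DN N.
Variable chi : nat -> fn.
Hypothesis VC : vanishing_cutoff mu DE0 E0 DN N chi.
Local Notation pp := (partial_potential mu U).

(** The bridge from [G] to [U]: [G a h] lies in the common domain [DL], and [L (G a h)] equals
    [a *: G a h - h] a.e. *)
Lemma resolvent_generator_value a h : 0 < a -> Lp mu 2%:E h ->
  has_generator_value mu U (G a h) (a *: G a h - h).
Proof.
move=> a0 ph; have pu := resolvent_Lp2 CG a0 ph.
have [_ GUv] := GU; have [pLu gen] := GUv _ (resolvent_dom CG RG a0 ph).
have [LL /(_ a a0)[_ /(_ h ph) LE]] := RG.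
apply/cvgrPdist_le => e e0; move/cvgrPdist_le : gen => /(_ e e0).
have : \forall t \near (0 : R)^'+, 0 < t by exact: nbhs_right_gt.
apply: filterS2 => t t0; have pUu : Lp mu 2%:E (t^-1 *: (U t (G a h) - G a h)).
  by apply: LpZ => //; apply: LpB => //; exact: (semigroup_Lp2 CU).
rewrite (@ae_pnorm2 _ _ _ mu _ (t^-1 *: (U t (G a h) - G a h) - (a *: G a h - h)))//.
- exact: Lp_measurable (LpB lt12 pUu pLu).
- exact: Lp_measurable (LpB lt12 pUu (LpB lt12 (LpZ a lt12 pu) ph)).
- by apply: filterS LE => x /[apply]; rewrite !fctE => ->.
Qed.

Lemma measurable_bounded_potential f (M : R) : Lp mu 1%E f ->
  measurable [set x | forall n, pp n f x <= M].
Proof.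
move=> pf; rewrite (_ : [set x | _] = \bigcap_n [set x | pp n f x <= M]); last first.
  by apply/seteqP; split => x h n => [_|]; exact: h.
apply: bigcapT_measurable => n; apply: measurable_le_set => //.
by have [/Lp_measurable] := partial_potentialP CU LU n pf.
Qed.

Lemma unbounded_potential f : Lp mu 1%E f -> ae_nonneg mu f ->
  {ae mu, forall x, 0 < f x -> forall M : R, exists n, M < pp n f x}.
Proof.
move=> pf f0; have mf := Lp_measurable pf; have /Lp1P itf := pf.
pose B k := [set x | k.+1%:R^-1 <= `|f x|] `&` [set x | `|f x| <= k.+1%:R] `&`
  [set x | forall n, pp n f x <= k.+1%:R].
suff BN k : {ae mu, forall x, ~ B k x}.
  have : {ae mu, forall x k, ~ B k x} by apply/ae_foralln.
  apply: filterS => x nB fx0 M; apply: contrapT => nM.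
  (* One index large enough for all three conditions of [B k] at a point where [f x > 0] and the
     partial potentials stay below [M]. *)
  pose k := (Num.truncn `|f x| + Num.truncn `|f x|^-1 + Num.truncn `|M|)%N.
  have trunc (r : R) : (Num.truncn r <= k)%N -> r <= k.+1%:R.
    by move=> rk; apply: le_trans (ltW (truncnS_gt _)) _; rewrite ler_nat ltnS.
  apply: (nB k); split; first split => /=.
  - rewrite invf_ple ?posrE ?normr_gt0 ?gt_eqF//; apply: trunc.
    by rewrite /k -addnA addnCA leq_addr.
  - by apply: trunc; rewrite /k -addnA leq_addr.
  - move=> n; apply: (@le_trans _ _ M).
      by rewrite leNgt; apply/negP => h; apply: nM; exists n.
    by apply: le_trans (ler_norm _) _; apply: trunc; rewrite /k leq_addl.
have k0 : (0 : R) < k.+1%:R by [].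
have ki0 : (0 : R) < k.+1%:R^-1 by rewrite invr_gt0.
have [mA Afin] := level_set_finite itf ki0.
have mB : measurable (B k).
  apply: measurableI; last exact: measurable_bounded_potential.
  apply: measurableI => //; apply: measurable_le_set => //; exact: measurableT_comp.
have Bfin : (mu (B k) < +oo)%E.
  by apply: le_lt_trans Afin; apply: le_measure; rewrite ?inE// => x [[]].
pose h : fn := f \* \1_(B k).
have hE x : B k x -> h x = f x by move=> Bx; rewrite /h /= indicE mem_set// mulr1.
have hN x : ~ B k x -> h x = 0 by move=> Bx; rewrite /h /= indicE memNset// mulr0.
have hf x : `|h x| <= `|f x|.
  by have [/hE->|/hN->] := pselect (B k x); rewrite ?normr0.
have mh : measurable_fun setT h.
  by apply: measurable_funM => //; exact: measurable_indic.
have ph1 : Lp mu 1%E h by apply/Lp1P; apply: le_itg (itg_norm itf) _ => //; exact: aeW.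
have hk x : `|h x| <= k.+1%:R.
  have [Bx|/hN->] := pselect (B k x); last by rewrite normr0.
  by rewrite hE//; case: Bx => -[].
have ph : Lp mu 2%:E h.
  apply/Lp2P; split => //; apply: (le_itg _ (itgZ k.+1%:R (itg_norm itf))).
    exact: measurable_funX.
  by apply: aeW => x; rewrite normrX expr2 ler_pM.
have hC : {ae mu, forall x, 0 <= h x <= k.+1%:R}.
  apply: filterS f0 => x f0; rewrite (le_trans (ler_norm _) (hk x)) andbT.
  by have [/hE->|/hN->] := pselect (B k x).
have hlef : {ae mu, forall x, h x <= f x}.
  by apply: filterS f0 => x f0; have [/hE->|/hN->] := pselect (B k x).
have GM a : 0 < a -> {ae mu, forall x, G a h x <= k.+1%:R}.
  move=> a0; apply: (maximum_principle CG SG a0 k0 k0 ph hC).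
  have := resolvent_le_on CU LU pf f0 ph1 ph hlef a0 (resolvent_Lp2 CG a0 ph)
    (resolvent_generator_value a0 ph) mB Bfin (M := k.+1%:R).
  move=> /(_ (fun x n Bx => Bx.2 n)); apply: filterS => x uM.
  by have [/uM|/hN] := pselect (B k x); [right|left].
(* So [h] vanishes a.e., although it equals [f] on [B k], where [|f|] is at least [k.+1%:R^-1]. *)
have := bounded_potential_eq0 CG SG RG DEC VC k0 k0 ph1 ph hC GM.
apply: filterS => x /(_ I) hx Bx; case: (Bx) => -[/= + _] _.
by rewrite -(hE _ Bx) hx normr0 leNgt ki0.
Qed.

Lemma potential_dichotomy : recurrent mu U.
Proof.
move=> f pf f0.
(* Integer levels exhaust the points with bounded partial potentials, at the cost of countably many
   null sets. *)
pose D k := [set x | forall n, pp n f x <= k.+1%:R].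
have mD k : measurable (D k) by exact: measurable_bounded_potential.
have UD k p j : {ae mu, forall x, D k x -> U (j.+1%:R * mesh R p) f x = 0}.
  set t := j.+1%:R * mesh R p; have t0 : 0 < t := node_gt0 R j p.
  pose n := (Num.truncn t).+1.
  have tn : t <= n%:R by apply: ltW; exact: truncnS_gt.
  have pUf := semigroup_Lp1 LU t0 pf; have Uf0 := L1_positive LU t0 pf f0.
  have shift : {ae mu, forall x m, pp m (U t f) x <= pp (m + n) f x}.
    by apply/ae_foralln => m; exact: (partial_potential_shift CU LU).
  apply: filterS3 Uf0 shift (unbounded_potential pUf Uf0) => x Ux0 shx unb Dx.
  apply/eqP; rewrite eq_le Ux0 andbT leNgt; apply/negP => /unb/(_ k.+1%:R)[m].
  by apply/negP; rewrite -leNgt (le_trans (shx m)).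
have ppD : {ae mu, forall x k n, D k x -> pp n f x = 0}.
  apply/ae_foralln => k; apply/ae_foralln => n.
  exact: (partial_potential_eq0 CU LU n (mD k) pf f0 (UD k)).
apply: filterS2 ppD (partial_potential_mono CU LU pf f0) => x ppD nd.
have [[k Dk]|nD] := pselect (exists k, D k x).
  left; rewrite /potential; apply: cvg_lim => //.
  apply: cvg_near_cst; apply: nearW => n.
  by rewrite -[bochner_integral _ _ _]/(pp n f) (ppD k).
right; apply/eqyP => A A0; have [n An] : exists n, A < pp n f x.
  apply: contrapT => nA; apply: nD; exists (Num.truncn A) => n.
  rewrite (le_trans _ (ltW (truncnS_gt _)))// leNgt.
  by apply/negP => An; apply: nA; exists n.
by apply: le_trans (le_potential n nd); rewrite lee_fin ltW.
Qed.

Lemma not_transient : mu setT != 0%E -> ~ transient mu U.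
Proof.
move=> muT [g [pg g0 potg]].
have g0' : ae_nonneg mu g by apply: filterS g0 => x /ltW.
(* An impossible property holding a.e. makes the whole space negligible, against [mu setT != 0]. *)
have : {ae mu, forall x : T, False}.
  have := unbounded_potential pg g0'; have := partial_potential_mono CU LU pg g0'.
  have both : {ae mu, forall x, 0 < g x /\ (potential mu U g x < +oo)%E}.
    by apply: filterS2 g0 potg.
  apply: filterS3 both => x [gx potx] nd /(_ gx) unb.
  (* A real lower bound excludes the value [-oo], so that [fine] returns the potential itself. *)
  have pot0 := le_potential 0 nd.
  have [n] := unb (fine (potential mu U g x)); apply/negP; rewrite -leNgt.
  rewrite -lee_fin fineK; first exact: le_potential.
  by rewrite fin_real// potx andbT; apply: lt_le_trans pot0; exact: ltNyr.
rewrite /prop_near1 /= /nbhs /= /almost_everywhere.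
have -> : ~` [set x : T | False] = setT by rewrite -setC0; congr (~` _); apply/seteqP.
by move/(measure_negligible measurableT)/eqP; rewrite (negbTE muT).
Qed.

End conservativity.

Theorem corollary8 (R : realType) (E : ptopologicalType)
    (mu : {measure set (borel E) -> \bar R})
    (V : set (borel E -> R)) (A : (borel E -> R) -> (borel E -> R) -> R)
    (DLam : set (borel E -> R)) (Lam : (borel E -> R) -> (borel E -> R))
    (G Ghat : R -> (borel E -> R) -> (borel E -> R))
    (DL : set (borel E -> R)) (L : (borel E -> R) -> (borel E -> R))
    (T That : R -> (borel E -> R) -> (borel E -> R))
    (DE0 : set (borel E -> R)) (E0 : (borel E -> R) -> (borel E -> R) -> R)
    (DN : set (borel E -> R)) (N : (borel E -> R) -> (borel E -> R)) :
  hausdorff_space E ->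
  borel_generated_by_continuous R E ->
  sigma_finite setT mu ->
  mu setT != 0%E ->
  dirichlet_form mu V A ->
  admissible_generator mu V A DLam Lam ->
  gdf_resolvent mu V A DLam Lam G ->
  adjoint_family mu G Ghat ->
  resolvent_generator mu G DL L ->
  C0_contraction_semigroup mu T ->
  semigroup_generator mu T DL L ->
  semigroup_of_resolvent mu That Ghat ->
  (forall t, 0 < t -> sub_markovian mu (That t)) ->
  L1_extension mu T ->
  decomposition mu DL L DE0 E0 DN N ->
  ((exists chi, vanishing_cutoff mu DE0 E0 DN N chi) ->
     ~ transient mu T) /\
  (strictly_irreducible mu T ->
   (exists chi, vanishing_cutoff mu DE0 E0 DN N chi) ->
     recurrent mu T).
Proof.
move=> _ _ _ muT _ _ [CG SG _] _ RG CT GT _ _ LT DEC.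
split=> [[chi VC]|_ [chi VC]].
  exact: (not_transient CT LT CG SG RG GT DEC VC).
exact: (potential_dichotomy CT LT CG SG RG GT DEC VC).
Qed.
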